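(* Let $n\ge 2$ and let $\Omega\subset\mathbb{C}^n$ be a bounded domain. If $u,v\in MPSH_{loc}(\Omega)$ and $\chi:\mathbb{R}\to\mathbb{R}$ is a convex non-decreasing function, then the function $(z,w)\mapsto \chi(u(z)+v(w))$ belongs to $MPSH(\Omega\times\Omega)$, where $\Omega\times\Omega\subset\mathbb{C}^{2n}$.
   Context: For an open set $D\subset\mathbb{C}^N$, $PSH(D)$ denotes the set of plurisubharmonic functions on $D$ (not identically $-\infty$ on any component). A function $u\in PSH(D)$ is called maximal if for every open set $G\Subset D$ and every upper semicontinuous function $v$ on $\overline{G}$ such that $v\in PSH(G)$ and $v|_{\partial G}\le u|_{\partial G}$, one has $v\le u$ on $G$. $MPSH(D)$ denotes the set of maximal functions in $PSH(D)$. $MPSH_{loc}(D)$ denotes the set of $u\in PSH(D)$ such that for every $z\in D$ there is an open set $U$ with $z\in U\Subset D$ and $u|_U\in MPSH(U)$. For a convex non-decreasing $\chi$ one sets $\chi(-\infty)=\lim_{t\to-\infty}\chi(t)\in[-\infty,\infty)$. *)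

(* Defs.v *)
From HB Require Import structures.
From mathcomp Require Import all_boot all_order all_algebra.
From mathcomp Require Import complex.
From mathcomp Require Import all_classical all_reals all_analysis.

Set Implicit Arguments.
Unset Strict Implicit.
Unset Printing Implicit Defensive.

Import Order.TTheory GRing.Theory Num.Theory.
Import numFieldNormedType.Exports.

Local Open Scope classical_set_scope.
Local Open Scope ring_scope.
Local Open Scope complex_scope.

(* The library attaches topologies to abstract numeric fields only; give R[i]
   the topology and norm of its modulus, so that 'rV[R[i]]_N is C^N with the
   product topology and the sup norm. *)
HB.instance Definition _ (R : realType) :=
  PseudoPointedMetric.copy R[i] (R[i])^o.
HB.instance Definition _ (R : realType) :=
  NormedModule.copy R[i] (R[i])^o.

Section plurisubharmonic.
Context {R : realType}.
Local Open Scope ereal_scope.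

(* Functions are total with values in \bar R; only their values on the given
   set A matter. Finiteness from above is part of the definition: the values
   of f on A lie in [-oo, +oo[. *)
Definition usc_on {X : topologicalType} (A : set X) (f : X -> \bar R) : Prop :=
  (forall x, A x -> f x < +oo) /\
  (forall x (a : R), A x -> f x < a%:E ->
    \forall y \near within A (nbhs x), f y < a%:E).

Definition circle_mean (f : R[i] -> \bar R) (c : R[i]) (r : R) : \bar R :=
  ((2 * pi)^-1)%:E *
  \int[lebesgue_measure]_(t in `[0%R, (2 * pi)%R])
    f (c + r%:C * (cos t +i* sin t))%R.

(* Being identically -oo (on V or on some components of V) is allowed here. *)
Definition subharmonic_or_ninfty (V : set R[i]) (f : R[i] -> \bar R) : Prop :=
  usc_on V f /\
  (forall (c : R[i]) (r : R), (0 < r)%R ->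
    [set z | (`|z - c| <= r%:C)%R] `<=` V -> f c <= circle_mean f c r).

Definition PSH {N : nat} (D : set 'rV[R[i]]_N) (u : 'rV[R[i]]_N -> \bar R)
    : Prop :=
  [/\ usc_on D u,
      forall a b : 'rV[R[i]]_N,
        subharmonic_or_ninfty [set z : R[i] | D (a + z *: b)%R]
                              (fun z => u (a + z *: b)%R) &
      forall x, D x -> exists2 y, connected_component D x y & u y != -oo].

Definition compactly_contained {X : topologicalType} (G D : set X) : Prop :=
  precompact G /\ closure G `<=` D.

Definition MPSH {N : nat} (D : set 'rV[R[i]]_N) (u : 'rV[R[i]]_N -> \bar R)
    : Prop :=
  PSH D u /\
  forall (G : set 'rV[R[i]]_N) (v : 'rV[R[i]]_N -> \bar R),
    open G -> compactly_contained G D ->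
    usc_on (closure G) v -> PSH G v ->
    (forall x, (closure G `\` G°) x -> v x <= u x) ->
    forall x, G x -> v x <= u x.

Definition MPSH_loc {N : nat} (D : set 'rV[R[i]]_N) (u : 'rV[R[i]]_N -> \bar R)
    : Prop :=
  PSH D u /\
  forall z, D z -> exists U : set 'rV[R[i]]_N,
    [/\ open U, U z, compactly_contained U D & MPSH U u].

(* The value at +oo is never reached by sums of plurisubharmonic functions. *)
Definition extend_ninfty (chi : R -> R) (x : \bar R) : \bar R :=
  match x with
  | r%:E => (chi r)%:E
  | -oo => lim ((chi t)%:E @[t --> -oo%R])
  | +oo => +oo
  end.

(* C^n x C^n is identified with C^(n + n) by row_mx. *)
Definition cprod {n : nat} (A B : set 'rV[R[i]]_n) : set 'rV[R[i]]_(n + n) :=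
  [set x | A (lsubmx x) /\ B (rsubmx x)].

Definition chi_sum {n : nat} (chi : R -> R) (u v : 'rV[R[i]]_n -> \bar R)
    (x : 'rV[R[i]]_(n + n)) : \bar R :=
  extend_ninfty chi (u (lsubmx x) + v (rsubmx x)).

End plurisubharmonic.

(* Main.v *)
(** Truncating [chi] from below exhibits [chi (u + v)] as a decreasing limit of
    bounded functions [s]. For a bounded [s], maximality is a local property: if
    [f <= s] on the boundary but not inside, start where [f - s + d |x|^2] is
    almost maximal; moving to the boundary of a ball of fixed radius [r] there
    gains [d r^2], which contradicts the local comparison. No semicontinuity of
    [f - s] is used.

    Locally, a maximal [u] bounds from above the limit of [T^k phi], where [phi]
    is [u] outside a ball and a large constant inside, and [T phi x] is the infimum
    of [Re P(0)] over the affine discs through [x] and the polynomials [P] with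
    [phi <= Re P] on the boundary circle; by the Fejer kernel these polynomials
    compute circle means, so that the limit is plurisubharmonic. If [Re P] and
    [Re Q] are such majorants on a disc in [z] and on a disc in [w], then
    [chi (Re (P + Q))] is maximal on the bidisc, because at every point there is a
    direction in which [d(P + Q) = 0]. A double induction on the numbers of
    iterations of [T] then gives [f <= chi (T^k phi1 (z) + T^l phi2 (w))]. *)
Require Import Defs.
From HB Require Import structures.
From mathcomp Require Import all_boot all_order all_algebra.
From mathcomp Require Import complex ring lra.
From mathcomp Require Import all_classical all_reals all_analysis.
From mathcomp Require Import measurable_realfun.
Import Order.TTheory GRing.Theory Num.Theory.
Import numFieldNormedType.Exports.
Import Normc.
Set Implicit Arguments.
Unset Strict Implicit.
Unset Printing Implicit Defensive.
Local Open Scope classical_set_scope.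
Local Open Scope ring_scope.

(** A maximal function need be neither continuous nor finite, and there need be no foliation by
    discs on which it is harmonic; the discs that almost realise the infimum in [T] are the
    substitute. The value inside the ball is constant so that the double induction can start: with
    one summand constant, the claim on a fibre is a maximum principle with a constant bound. In the
    inductive step, each boundary point of a bidisc has a variable on its circle, and there the
    hypothesis with one envelope fewer applies. Testing sub-mean values against polynomials alone
    keeps the argument algebraic: the condition is stable under affine changes of parameter and
    under adding real parts of affine functions, and integrals enter only in passing to and from
    [PSH]. The truncation of [chi] serves twice: it bounds the difference with a competitor, so that
    a finite supremum exists, and its constancy near [-oo] lets the points where [u + v] is [-oo] be
    reached through real arguments. *)

Section usc.
Context {R : realType}.

(** * Upper semicontinuous functions on compact sets *)

Lemma lte_real_between (a b : \bar R) : (a < b)%E ->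
  exists2 r : R, (a < r%:E)%E & (r%:E < b)%E.
Proof.
case: a b => [a||] [b||] // ab.
- by rewrite lte_fin in ab; exists ((a + b) / 2)%R; rewrite lte_fin; lra.
- by exists (a + 1)%R; rewrite ?ltry// lte_fin; lra.
- by exists (b - 1)%R; rewrite ?ltNyr// lte_fin; lra.
- by exists 0; rewrite ?ltNyr ?ltry.
Qed.

(** If the supremum [s] is not attained, the sets [f < a] with [a < s] cover [K], and by compactness
    one of them contains [K]. The filter [F] of values tending to [s] from below expresses this as a
    near-covering. *)
Lemma usc_max (X : topologicalType) (K : set X) (f : X -> \bar R) :
  compact K -> K !=set0 -> usc_on K f ->
  exists2 p, K p & forall x, K x -> (f x <= f p)%E.
Proof.
move=> cK [x0 Kx0] [_ uf]; pose s := ereal_sup (f @` K).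
have fs x : K x -> (f x <= s)%E by move=> Kx; apply: ereal_sup_ubound; exists x.
have [[p Kp fp]|nomax] := pselect (exists2 p, K p & f p = s).
  by exists p => // x Kx; rewrite fp; exact: fs.
have lts x : K x -> (f x < s)%E.
  move=> Kx; rewrite lt_neqAle fs// andbT; apply/eqP => fxs.
  by apply: nomax; exists x.
pose F := filter_from [set a : \bar R | (a < s)%E] (fun a => [set i | (a <= i)%E /\ (i < s)%E]).
have FF : Filter F.
  apply: filter_from_filter; first by exists (f x0); exact: lts.
  move=> a b /= ha hb; exists (maxe a b); first by rewrite /= gt_max ha hb.
  by move=> i [] /=; rewrite ge_max => /andP[].
have := (compact_near_coveringP K).1 cK _ F (fun i x => K x -> (f x < i)%E) FF.
case.
  move=> x Kx.
  have [r fr rs] := lte_real_between (lts x Kx).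
  exists ([set x' | K x' -> (f x' < r%:E)%E], [set i | (r%:E <= i)%E /\ (i < s)%E]).
    split => /=; last by exists r%:E.
    by move/(_ _ _ Kx fr): uf; rewrite near_withinE.
  by move=> [x' i] [/= h [ri _]] Kx'; exact: lt_le_trans (h Kx') ri.
move=> a /= as_ /(_ a) h.
have {}h : K `<=` (fun x => K x -> (f x < a)%E) by apply: h.
suff : (s <= a)%E by rewrite leNgt as_.
by apply: ge_ereal_sup => _ [x Kx <-]; apply/ltW/h.
Qed.

Lemma usc_compact_bound (T : topologicalType) (K : set T) (f : T -> \bar R) :
  compact K -> usc_on K f -> exists2 M : R, 0 <= M & forall x, K x -> (f x <= M%:E)%E.
Proof.
move=> cK uf; have [[x0 Kx0]|K0] := pselect (K !=set0); last first.
  by exists 0 => // x Kx; case: K0; exists x.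
have [p Kp pm] := usc_max cK (ex_intro _ x0 Kx0) uf.
exists (Num.max 0 (fine (f p))); first by rewrite le_max lexx.
move=> x Kx; apply: le_trans (pm x Kx) _; have := uf.1 p Kp.
by case: (f p) => [a||]//= _; rewrite ?leNye// lee_fin le_max lexx orbT.
Qed.

Lemma continuous_compact_bound (T : topologicalType) (K : set T) (f : T -> R) :
  compact K -> continuous f -> exists2 M : R, 0 <= M & forall x, K x -> f x <= M.
Proof.
move=> cK cf; suff /(usc_compact_bound cK)[M M0 fM] : usc_on K (EFin \o f).
  by exists M => // x /fM.
split=> [x _|x c _]; first by rewrite /= ltry.
rewrite /= lte_fin => fc; near=> t; rewrite /= lte_fin; near: t.
by apply: cvg_within; exact: (cvgr_lt _ (cf x)).
Unshelve. all: by end_near. Qed.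

End usc.

(** * The weak sub-mean inequality and a maximum principle *)

Section wsub.
Context {R : realType}.
Implicit Types (E : normedModType R[i]).

(** The sub-mean inequality for boundary majorants that are real parts of polynomials; their circle
    mean is [Re P.[0]], so no integral appears. The radius of the disc is absorbed in [b]. *)
Definition weak_submean E (G : set E) (f : E -> \bar R) := forall (p b : E) (P : {poly R[i]}),
  (forall z : R[i], `|z| <= 1 -> G (p + z *: b)) ->
  (forall z : R[i], `|z| = 1 -> (f (p + z *: b)%R <= (complex.Re P.[z])%:E)%E) ->
  (f p <= (complex.Re P.[0])%:E)%E.

(** Where [f - T] attains a positive maximum [s], the bound [f <= T + s <= Re P + s - k] on the
    circle yields [f p <= T p + s - k], a contradiction. The last hypothesis is strict
    superharmonicity of [T] along one disc centred at [p], whose direction may depend on [p]. *)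
Lemma max_principle E (K G : set E) (f : E -> \bar R) (T : E -> R) :
  compact K -> G `<=` K -> usc_on K f -> weak_submean G f ->
  (forall x, K x -> T y @[y --> x] --> T x) ->
  (forall x, K x -> ~ G x -> (f x <= (T x)%:E)%E) ->
  (forall p, G p -> exists b : E, exists P : {poly R[i]}, exists2 k : R, 0 < k &
    [/\ forall z : R[i], `|z| <= 1 -> G (p + z *: b),
      forall z : R[i], `|z| = 1 -> T (p + z *: b) <= complex.Re P.[z] - k &
      complex.Re P.[0] = T p]) ->
  forall x, K x -> (f x <= (T x)%:E)%E.
Proof.
move=> cK GK [fy uf] sf cT bd str x Kx; rewrite leNgt; apply/negP => Tf.
pose g y := (f y - (T y)%:E)%E.
have ug : usc_on K g.
  split=> [y Ky|y a Ky].
    by rewrite /g; have := fy y Ky; case: (f y) => [c||]// _; rewrite ?ltry// ltNye.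
  rewrite /g lteBlDr// -EFinD => fya.
  have [r fr] := lte_real_between fya; rewrite lte_fin => rs.
  have h1 := uf y r Ky fr.
  have h2 : \forall z \near within K (nbhs y), r - a < T z.
    by apply: cvg_within; apply: (cvgr_gt _ (cT y Ky)); lra.
  near=> z; rewrite lteBlDr// -EFinD.
  apply: (@lt_trans _ _ r%:E); first by near: z.
  rewrite lte_fin; suff : r - a < T z by lra.
  by near: z.
have [p Kp pm] := usc_max cK (ex_intro _ x Kx) ug.
have gp : (0 < g p)%E.
  by apply: lt_le_trans (pm x Kx); rewrite /g lteBrDr// add0e.
have [Gp|nGp] := pselect (G p); last first.
  by move: gp; rewrite /g sube_gt0 ltNge bd.
have [s fs s0] : exists2 s, f p = (T p + s)%:E & 0 < s.
  move: gp; rewrite /g; have := fy p Kp; case: (f p) => [a||]// _.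
  by rewrite lte_fin => h; exists (a - T p) => //; congr EFin; ring.
have [b [P [k k0 [Gb Tb P0]]]] := str p Gp.
have := sf p b (P + (s - k)%:C%C%:P) Gb.
have PE z : complex.Re (P + (s - k)%:C%C%:P).[z] = complex.Re P.[z] + (s - k).
  by rewrite hornerD hornerC raddfD.
rewrite fs PE P0 => /(_ _)/wrap[].
  move=> z z1; have := pm (p + z *: b) (GK _ (Gb z _)); rewrite z1 lexx => /(_ isT).
  rewrite /g fs => h.
  have : (f (p + z *: b)%R <= (T (p + z *: b) + s)%:E)%E.
    move: h; rewrite -EFinB leeBlDr// -EFinD => /le_trans; apply.
    by rewrite lee_fin; lra.
  move/le_trans; apply; rewrite lee_fin PE; have := Tb z z1; lra.
by rewrite lee_fin => h; clear -h k0; lra.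
Unshelve. all: by end_near. Qed.

End wsub.

(** * Integrals over the circle and real parts of polynomials *)

Section circle_integral.
Import HBNNSimple.
Context {R : realType}.
Implicit Types (f g : R -> R).

Definition cis (t : R) : R[i] := (cos t +i* sin t)%C.

Definition cint g : R := \int[lebesgue_measure]_(t in `[0, 2 * pi]) g t.

(** The integral of a nonnegative function is a supremum over the simple functions below it, which
    is monotone for arbitrary functions; the general case splits into positive and negative
    parts. *)
Lemma integral_mono d (T : measurableType d) (mu : {measure set T -> \bar R})
    (D : set T) (f g : T -> \bar R) :
  (forall x, D x -> f x <= g x)%E ->
  (\int[mu]_(x in D) f x <= \int[mu]_(x in D) g x)%E.
Proof.
move=> fg.
have mono (a b : T -> \bar R) : (forall x, 0 <= a x)%E -> (forall x, a x <= b x)%E ->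
    (\int[mu]_x a x <= \int[mu]_x b x)%E.
  move=> a0 ab; rewrite !ge0_integralTE//; last by move=> x; exact: le_trans (ab x).
  apply: ge_ereal_sup => _ [h /= hab <-]; apply: ereal_sup_ubound; exists h => //= x.
  exact: le_trans (hab x) (ab x).
rewrite [leLHS]integral_mkcond [leRHS]integral_mkcond.
have {}fg x : ((f \_ D) x <= (g \_ D) x)%E.
  by rewrite /patch; case: ifPn => // /set_mem; exact: fg.
rewrite [leLHS]integralE [leRHS]integralE leeB//; apply: mono => // x.
  by rewrite !funeposE ge_max !le_max fg lexx orbT.
by rewrite !funenegE ge_max !le_max leeN2 fg lexx orbT.
Qed.

Let pi2_gt0 : 0 < 2 * pi :> R.
Proof. by rewrite mulr_gt0// pi_gt0. Qed.

Lemma cont_integrable g : continuous g ->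
  lebesgue_measure.-integrable `[0, 2 * pi] (EFin \o g).
Proof.
move=> cg; apply: continuous_compact_integrable; first exact: segment_compact.
exact: continuous_subspaceT.
Qed.

Lemma cintD f g : continuous f -> continuous g ->
  cint (fun t => f t + g t) = cint f + cint g.
Proof. by move=> cf cg; apply: RintegralD => //; exact: cont_integrable. Qed.

Lemma cintZ a f : continuous f -> cint (fun t => a * f t) = a * cint f.
Proof. by move=> cf; apply: RintegralZl => //; exact: cont_integrable. Qed.

Lemma cint_cst a : cint (fun=> a) = a * (2 * pi).
Proof.
rewrite /cint Rintegral_cst//=.
rewrite lebesgue_measure_itv/= lte_fin pi2_gt0.
by rewrite -EFinB subr0.
Qed.

Lemma cint_le f g : continuous f -> continuous g ->
  (forall t, f t <= g t) -> cint f <= cint g.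
Proof.
by move=> cf cg fg; apply: le_Rintegral => //; exact: cont_integrable.
Qed.

Lemma continuous_cst_fun (a : R) : continuous (fun _ : R => a).
Proof. by move=> ?; exact: cvg_cst. Qed.

Lemma continuous_sum_fun n (F : nat -> R -> R) : (forall i, continuous (F i)) ->
  continuous (fun t => \sum_(i < n) F i t).
Proof.
move=> cF; elim: n => [|n ih] t.
  by under eq_fun do rewrite big_ord0; exact: cvg_cst.
rewrite (_ : (fun t => _) = (fun t => \sum_(i < n) F i t + F n t)); last first.
  by apply/funext => s; rewrite big_ord_recr.
by apply: cvgD; [exact: ih|exact: cF].
Qed.

Lemma cint_sum n (F : nat -> R -> R) : (forall i, continuous (F i)) ->
  cint (fun t => \sum_(i < n) F i t) = \sum_(i < n) cint (F i).
Proof.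
move=> cF; elim: n => [|n ih].
  rewrite big_ord0 -[RHS](mul0r (2 * pi)) -cint_cst; congr cint.
  by apply/funext => t; rewrite big_ord0.
rewrite big_ord_recr/= -ih -cintD//; last first.
  exact: continuous_sum_fun.
by congr cint; apply/funext => t; rewrite big_ord_recr.
Qed.

Lemma cint_deriv F f : (forall t : R, is_derive t (1 : R) F (f t)) ->
  continuous f -> F (2 * pi) = F 0 -> cint f = 0.
Proof.
move=> dF cf F2.
have cF : continuous F.
  by move=> t; apply/differentiable_continuous/derivable1_diffP/(@ex_derive _ _ _ _ _ _ _ (dF t)).
rewrite /cint /Rintegral (@continuous_FTC2 _ f F 0 (2 * pi))//.
- by rewrite F2 -EFinB subrr.
- exact: continuous_subspaceT.
- split => //.
  + exact: cvg_at_right_filter (cF _).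
  + exact: cvg_at_left_filter (cF _).
- by move=> x _; rewrite derive1E; exact: (@derive_val _ _ _ _ _ _ _ (dF x)).
Qed.

Lemma is_derive_continuous f F : (forall t : R, is_derive t (1 : R) F (f t)) -> continuous F.
Proof.
by move=> dF t; apply/differentiable_continuous/derivable1_diffP/(@ex_derive _ _ _ _ _ _ _ (dF t)).
Qed.

Lemma is_derive_cosM (a t : R) : is_derive t (1 : R) (fun s => cos (a * s)) (- a * sin (a * t)).
Proof.
have h : is_derive t (1:R) (fun s : R => a * s) a.
  by apply: is_derive_eq; rewrite /GRing.scale/= mulr1.
have := @is_derive1_comp R (@cos R) (fun s : R => a * s) t _ _ (is_derive_cos _) h.
by move/is_derive_eq; apply; rewrite mulrC mulrN mulNr.
Qed.

Lemma is_derive_sinM (a t : R) : is_derive t (1 : R) (fun s => sin (a * s)) (a * cos (a * t)).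
Proof.
have h : is_derive t (1:R) (fun s : R => a * s) a.
  by apply: is_derive_eq; rewrite /GRing.scale/= mulr1.
have := @is_derive1_comp R (@sin R) (fun s : R => a * s) t _ _ (is_derive_sin _) h.
by move/is_derive_eq; apply; rewrite mulrC.
Qed.

Lemma continuous_cosM a : continuous (fun t : R => cos (a * t)).
Proof. exact: is_derive_continuous (is_derive_cosM a). Qed.

Lemma continuous_sinM a : continuous (fun t : R => sin (a * t)).
Proof. exact: is_derive_continuous (is_derive_sinM a). Qed.

Lemma periodicM (n : nat) : cos (n%:R * (2 * pi)) = 1 :> R /\ sin (n%:R * (2 * pi)) = 0 :> R.
Proof.
have -> : n%:R * (2 * pi) = 0 + (pi *+ 2) *+ n :> R.
  by rewrite add0r -[RHS]mulr_natl -[pi *+ 2]mulr_natl.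
rewrite (periodicn (@cosD2pi R)) (periodicn (@sinD2pi R)).
by rewrite cos0 sin0.
Qed.

Lemma cint_cosM n : cint (fun t => cos (n.+1%:R * t)) = 0.
Proof.
apply: (@cint_deriv (fun t => n.+1%:R^-1 * sin (n.+1%:R * t))).
- move=> t; have h := is_derive_sinM n.+1%:R t.
  by apply: is_derive_eq; rewrite /GRing.scale/= mulrA mulVf ?mul1r.
- exact: continuous_cosM.
- by rewrite (periodicM n.+1).2 !mulr0 sin0 ?mulr0.
Qed.

Lemma cint_sinM n : cint (fun t => sin (n.+1%:R * t)) = 0.
Proof.
apply: (@cint_deriv (fun t => - n.+1%:R^-1 * cos (n.+1%:R * t))).
- move=> t; have h := is_derive_cosM n.+1%:R t.
  by apply: is_derive_eq; rewrite /GRing.scale/= mulrA mulrNN mulVf ?mul1r.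
- exact: continuous_sinM.
- by rewrite (periodicM n.+1).1 mulr0 cos0.
Qed.

Lemma cisD s t : cis (s + t) = cis s * cis t.
Proof.
by rewrite /cis sinD cosD; apply/eqP; rewrite eq_complex /= addrC eqxx/=; apply/eqP; ring.
Qed.

Lemma cisX n t : cis t ^+ n = cis (n%:R * t).
Proof.
elim: n => [|n ih]; first by rewrite expr0 mul0r /cis cos0 sin0.
by rewrite exprS ih -cisD -add1n natrD mulrDl mul1r.
Qed.

Lemma normr_cis t : `|cis t| = 1.
Proof. by rewrite normc_def /= cos2Dsin2 sqrtr1. Qed.

Lemma cis_onto (z : R[i]) : `|z| = 1 -> exists t, z = cis t.
Proof.
case: z => x y; rewrite normc_def /= => -[].
move/(congr1 (fun u => u ^+ 2)); rewrite sqr_sqrtr ?addr_ge0 ?sqr_ge0// expr1n => xy.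
have x1 : -1 <= x <= 1 by have := sqr_ge0 y; rewrite !expr2 in xy *; move=> y2; apply/andP; split; nra.
have sy : sin (acos x) = `|y|.
  by rewrite sin_acos// -sqrtr_sqr; congr Num.sqrt; lra.
have cx : cos (acos x) = x by rewrite acosK// in_itv/=.
have [y0|y0] := leP 0 y.
  by exists (acos x); rewrite /cis cx sy ger0_norm.
by exists (- acos x); rewrite /cis cosN sinN cx sy ltr0_norm// opprK.
Qed.

Lemma Re_monomE (c : R[i]) n t : complex.Re (c * cis t ^+ n) =
  complex.Re c * cos (n%:R * t) + - complex.Im c * sin (n%:R * t).
Proof. by rewrite cisX /cis; case: c => c1 c2 /=; rewrite mulNr. Qed.

Lemma continuous_Re_monom (c : R[i]) n : continuous (fun t => complex.Re (c * cis t ^+ n)).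
Proof.
under eq_fun do rewrite Re_monomE.
by move=> t; apply: cvgD; apply: cvgM; do ?[exact: cvg_cst];
  [exact: continuous_cosM|exact: continuous_sinM].
Qed.

Lemma Re_hornerE (P : {poly R[i]}) t :
  complex.Re P.[cis t] = \sum_(i < size P) complex.Re (P`_i * cis t ^+ i).
Proof. by rewrite horner_coef raddf_sum. Qed.

Lemma continuous_Re_horner_cis (P : {poly R[i]}) :
  continuous (fun t => complex.Re P.[cis t]).
Proof.
under eq_fun do rewrite Re_hornerE.
by apply: (@continuous_sum_fun _ (fun i t => complex.Re (P`_i * cis t ^+ i))) => i; exact: continuous_Re_monom.
Qed.

Lemma cint_monom (c : R[i]) n :
  cint (fun t => complex.Re (c * cis t ^+ n.+1)) = 0.
Proof.
under eq_fun do rewrite Re_monomE.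
have cc (a b : R) : continuous (fun t => a * cos (b * t)).
  by move=> t; apply: cvgM; [exact: cvg_cst|exact: continuous_cosM].
have cs (a b : R) : continuous (fun t => a * sin (b * t)).
  by move=> t; apply: cvgM; [exact: cvg_cst|exact: continuous_sinM].
rewrite (cintD (cc _ _) (cs _ _)).
rewrite (cintZ _ (@continuous_cosM _)) (cintZ _ (@continuous_sinM _)).
by rewrite cint_cosM cint_sinM !mulr0 addr0.
Qed.

Lemma cint_Re_horner (P : {poly R[i]}) :
  cint (fun t => complex.Re P.[cis t]) = complex.Re P.[0] * (2 * pi).
Proof.
under eq_fun do rewrite Re_hornerE.
rewrite (@cint_sum _ (fun i t => complex.Re (P`_i * cis t ^+ i))); last first.
  by move=> i; exact: continuous_Re_monom.
rewrite horner_coef0; case sP: (size P) => [|n].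
  by rewrite big_ord0 nth_default ?sP// mul0r.
rewrite big_ord_recl big1 ?addr0; last by move=> i _; rewrite cint_monom.
rewrite -cint_cst; congr cint; apply/funext => t.
by rewrite expr0 mulr1.
Qed.

Lemma circle_mean_le (f g : R[i] -> \bar R) c r : (forall t, f (c + r%:C%C * cis t)%R <= g (c + r%:C%C * cis t)%R)%E ->
  (circle_mean f c r <= circle_mean g c r)%E.
Proof.
move=> fg; rewrite /circle_mean lee_pmul2l//; last first.
  by rewrite lte_fin invr_gt0.
by apply: integral_mono => t _; exact: fg.
Qed.

Lemma circle_mean_cont (f : R[i] -> \bar R) (g : R -> R) c r : continuous g ->
  (forall t, f (c + r%:C%C * cis t)%R = (g t)%:E) ->
  circle_mean f c r = ((2 * pi)^-1 * cint g)%:E.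
Proof.
move=> cg fg; rewrite /circle_mean EFinM; congr (_ * _)%E.
rewrite /cint /Rintegral fineK; last first.
  by apply: integrable_fin_num => //; exact: cont_integrable.
by apply: eq_integral => t _; exact: fg.
Qed.

Definition submean (E : lmodType R[i]) (G : set E) (f : E -> \bar R) :=
  forall p b : E, (forall z : R[i], `|z| <= 1 -> G (p + z *: b)) ->
   (f p <= circle_mean (fun z => f (p + z *: b)%R) 0%R 1%R)%E.

Lemma submean_weak (E : normedModType R[i]) (G : set E) (f : E -> \bar R) :
  submean G f -> weak_submean G f.
Proof.
move=> sf p b P Gb fb; apply: le_trans (sf p b Gb) _.
have := @circle_mean_le (fun z => f (p + z *: b)%R) (fun z => (complex.Re P.[z])%:E) 0 1.
move=> /(_ _)/wrap[].
  by move=> t; rewrite add0r mul1r; apply: fb; exact: normr_cis.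
move/le_trans; apply.
rewrite (@circle_mean_cont _ (fun t => complex.Re P.[cis t])); last 2 first.
- exact: continuous_Re_horner_cis.
- by move=> t; rewrite add0r mul1r.
by rewrite cint_Re_horner mulrC mulfK// gt_eqF.
Qed.

End circle_integral.

(** * Polynomial majorants of continuous functions on the circle *)

Section trig_majorant.
Context {R : realType}.
Implicit Types (f g : R -> R).

Lemma continuous_mulfun f g : continuous f -> continuous g -> continuous (fun t => f t * g t).
Proof. by move=> cf cg t; apply: cvgM; [exact: cf|exact: cg]. Qed.

Lemma continuous_addfun f g : continuous f -> continuous g -> continuous (fun t => f t + g t).
Proof. by move=> cf cg t; apply: cvgD; [exact: cf|exact: cg]. Qed.

(** Up to normalisation, the de la Vallee Poussin kernel: a nonnegative trigonometric polynomial
    that concentrates at [0] as [N] grows. *)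
Definition fejer N (s : R) : R := (1 + cos s) ^+ N.

Lemma fejer_ge0 N s : 0 <= fejer N s.
Proof. by rewrite /fejer exprn_ge0//; have := cos_geN1 s; lra. Qed.

Lemma is_derive_subl (f f' : R -> R) (a t : R) :
  (forall s : R, is_derive s (1 : R) f (f' s)) ->
  is_derive t (1 : R) (fun s => f (a - s)) (- f' (a - t)).
Proof.
move=> df.
have h : is_derive t (1:R) (fun s : R => a - s) (- 1).
  by apply: is_derive_eq; rewrite add0r mul1r.
have := @is_derive1_comp R f (fun s : R => a - s) t _ _ (df _) h.
by move/is_derive_eq; apply; rewrite mulrN1.
Qed.

Lemma continuous_subl f a : continuous f -> continuous (fun t : R => f (a - t)).
Proof.
move=> cf t; apply: continuous_comp; last exact: cf.
by apply: cvgB; [exact: cvg_cst|exact: cvg_id].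
Qed.

Lemma is_derive_fejer N (s : R) :
  is_derive s (1 : R) (@fejer N) (- (N%:R * (1 + cos s) ^+ N.-1 * sin s)).
Proof.
rewrite /fejer; have h : is_derive s (1:R) (fun t : R => 1 + cos t) (- sin s).
  by apply: is_derive_eq; rewrite ?add0r ?sub0r ?mul0r ?mul1r ?mulN1r ?addr0.
have := is_deriveX N h; rewrite exprfctE.
by move/is_derive_eq; apply; rewrite /GRing.scale/= mulrN.
Qed.

Lemma continuous_fejer N : continuous (@fejer N).
Proof. exact: is_derive_continuous (is_derive_fejer N). Qed.

(* The derivative of [fejer N * sin] integrates to zero over a period; it
   equals [fejer N * cos - N * fejer N * (1 - cos)]. *)
Lemma cint_fejer_moment N a :
  cint (fun t => fejer N (a - t)) =
  N.+1%:R * cint (fun t => fejer N (a - t) * (1 - cos (a - t))).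
Proof.
have ck : continuous (fun t => fejer N (a - t)) by apply: continuous_subl; exact: continuous_fejer.
have cc : continuous (fun t => cos (a - t)) by apply: continuous_subl; exact: continuous_cos.
have c1 : continuous (fun t => 1 - cos (a - t)).
  by move=> t; apply: cvgB; [exact: cvg_cst|exact: cc].
have ckc := continuous_mulfun ck c1.
have h : cint (fun t => N.+1%:R * (fejer N (a - t) * (1 - cos (a - t))) + -1 * fejer N (a - t)) = 0.
  apply: (@cint_deriv _ (fun t => fejer N (a - t) * sin (a - t))).
  - move=> t.
    have h1 := is_derive_subl a t (is_derive_fejer N).
    have h2 := is_derive_subl a t (@is_derive_sin R).
    apply: is_derive_eq; rewrite /GRing.scale/= /fejer.
    case: N {ck ckc h1} => [|N] /=; first by rewrite !expr0; ring.
    have := cos2Dsin2 (a - t); set c := cos _; set s := sin _ => cs.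
    have -> : - - (N.+1%:R * (1 + c) ^+ N * s) = N.+1%:R * (1 + c) ^+ N * s by rewrite opprK.
    have s2 : s * s = (1 - c) * (1 + c) by rewrite -!expr2; move: cs; rewrite !expr2; lra.
    have e : (1 + c) ^+ N.+1 = (1 + c) ^+ N * (1 + c) by rewrite exprSr.
    rewrite e; set q := (1 + c) ^+ N.
    rewrite (_ : s * (N.+1%:R * q * s) = N.+1%:R * q * (s * s)); last by ring.
    by rewrite s2 -!natr1; ring.
  - by apply: continuous_addfun => //; apply: continuous_mulfun => //; exact: continuous_cst_fun.
  - have d : a - 2 * pi + pi *+ 2 = a by rewrite -[pi *+ 2]mulr_natl; ring.
    have := @sinD2pi R (a - 2 * pi); have := @cosD2pi R (a - 2 * pi).
    by rewrite d /fejer subr0 => -> ->.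
move: h; rewrite cintD; do ?[by apply: continuous_mulfun => //; exact: continuous_cst_fun].
by rewrite !cintZ// mulN1r => /eqP; rewrite subr_eq0 => /eqP.
Qed.

(** Writing [1 + cos] as [2 - (1 - cos)], the moment identity gives the recursion [2 * c - c / N.+1]
    for the next integral; positivity and independence of [a] both follow. *)
Lemma cint_fejer N : exists2 c : R, 0 < c & forall a, cint (fun t => fejer N (a - t)) = c.
Proof.
elim: N => [|N [c c0 hc]].
  exists (2 * pi); first by rewrite mulr_gt0// pi_gt0.
  by move=> a; rewrite /fejer; under eq_fun do rewrite expr0; rewrite cint_cst mul1r.
exists (2 * c - N.+1%:R^-1 * c).
  have : N.+1%:R^-1 <= 1 :> R by rewrite invf_le1// ler1n.
  by move=> h; have := ler_wpM2r (ltW c0) h; rewrite mul1r; set x := _^-1 * c; lra.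
move=> a; have ck : continuous (fun t => fejer N (a - t)) by apply: continuous_subl; exact: continuous_fejer.
have c1 : continuous (fun t => 1 - cos (a - t)).
  by move=> t; apply: cvgB; [exact: cvg_cst|apply: continuous_subl; exact: continuous_cos].
have ckc := continuous_mulfun ck c1.
rewrite (_ : (fun t => _) = (fun t => 2 * fejer N (a - t) + -1 * (fejer N (a - t) * (1 - cos (a - t))))); last first.
  by apply/funext => t; rewrite /fejer exprS; ring.
rewrite cintD; do ?[by apply: continuous_mulfun => //; exact: continuous_cst_fun].
rewrite !cintZ// hc; have := cint_fejer_moment N a; rewrite hc => e.
by rewrite e [_^-1 * _]mulrA mulVf// mul1r mulN1r.
Qed.

(** Even trigonometric polynomials, generated so that a convolution can be treated term by term. *)
Inductive cos_span : (R -> R) -> Prop :=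
| cos_span_gen (a : R) (n : nat) : cos_span (fun s => a * cos (n%:R * s))
| cos_span_add g h : cos_span g -> cos_span h -> cos_span (fun s => g s + h s).

Lemma cos_span_mul g : cos_span g -> cos_span (fun s => g s * (1 + cos s)).
Proof.
elim=> [a n|{}g h _ ihg _ ihh]; last first.
  rewrite (_ : (fun s => _) = (fun s => g s * (1 + cos s) + h s * (1 + cos s))).
    exact: cos_span_add.
  by apply/funext => s; rewrite mulrDl.
case: n => [|n].
  rewrite (_ : (fun s => _) = (fun s => a * cos (0%:R * s) + a * cos (1%:R * s))).
    by apply: cos_span_add; exact: cos_span_gen.
  by apply/funext => s; rewrite mul0r cos0 mul1r; ring.
rewrite (_ : (fun s => _) = (fun s => a * cos (n.+1%:R * s) +
   (a / 2 * cos (n.+2%:R * s) + a / 2 * cos (n%:R * s)))).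
  by do ![apply: cos_span_add]; exact: cos_span_gen.
apply/funext => s.
have -> : n.+2%:R * s = n.+1%:R * s + s by rewrite -[n.+2]addn1 natrD mulrDl mul1r.
have -> : n%:R * s = n.+1%:R * s - s by rewrite -[n.+1]addn1 natrD mulrDl mul1r addrK.
by rewrite cosD cosB; field.
Qed.

Lemma cos_span_fejer N : cos_span (@fejer N).
Proof.
elim: N => [|N ih].
  rewrite (_ : @fejer 0 = (fun s => 1 * cos (0%:R * s))); first exact: cos_span_gen.
  by apply/funext => s; rewrite /fejer expr0 mul0r cos0 mul1r.
rewrite (_ : @fejer _ = (fun s => @fejer N s * (1 + cos s))); first exact: cos_span_mul.
by apply/funext => s; rewrite /fejer exprSr.
Qed.

Lemma cos_span_continuous g : cos_span g -> continuous g.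
Proof.
elim=> [a n|{}g h _ ihg _ ihh]; last exact: continuous_addfun.
by apply: continuous_mulfun; [exact: continuous_cst_fun|exact: continuous_cosM].
Qed.

Lemma cos_span_convolution g f : cos_span g -> continuous f ->
  exists F : {poly R[i]},
    (forall a, cint (fun t => f t * g (a - t)) = complex.Re F.[cis a]) /\
    complex.Re F.[0] * (2 * pi) = cint f * cint g.
Proof.
move=> sg cf; elim: sg => [k n|{}g h sg [F [F1 F2]] sh [H [H1 H2]]]; last first.
  have cg := cos_span_continuous sg; have ch := cos_span_continuous sh.
  exists (F + H); split.
    move=> a; rewrite hornerD raddfD/= -F1 -H1 -cintD.
    - by congr cint; apply/funext => t; rewrite mulrDr.
    - by apply: continuous_mulfun => //; exact: continuous_subl.
    - by apply: continuous_mulfun => //; exact: continuous_subl.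
  by rewrite hornerD raddfD/= mulrDl F2 H2 cintD// mulrDr.
pose A : R[i] := (k * cint (fun t => f t * cos (n%:R * t)) -i* (k * cint (fun t => f t * sin (n%:R * t))))%C.
have cfc : continuous (fun t => f t * cos (n%:R * t)).
  by apply: continuous_mulfun => //; exact: continuous_cosM.
have cfs : continuous (fun t => f t * sin (n%:R * t)).
  by apply: continuous_mulfun => //; exact: continuous_sinM.
exists (A *: 'X^n); split.
  move=> a; rewrite hornerZ hornerXn cisX /cis /=.
  rewrite (_ : (fun t => _) = (fun t => k * cos (n%:R * a) * (f t * cos (n%:R * t)) +
      k * sin (n%:R * a) * (f t * sin (n%:R * t)))).
    rewrite cintD; do ?[by apply: continuous_mulfun => //; exact: continuous_cst_fun].
    by rewrite !cintZ//; ring.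
  by apply/funext => t; rewrite mulrBr cosB; ring.
rewrite hornerZ hornerXn cintZ; last exact: continuous_cosM.
case: n @A {cfc cfs} => [|n] A; last by rewrite expr0n mulr0 cint_cosM mulr0 mulr0 mul0r.
rewrite expr0 mulr1 /A /=.
have e : (fun t : R => cos (0%:R * t)) = cst 1 by apply/funext => t; rewrite mul0r cos0.
rewrite [in RHS]e cint_cst.
have -> : (fun t => f t * cos (0%:R * t)) = f by apply/funext => t; rewrite mul0r cos0 mulr1.
by ring.
Qed.

(** The last hypothesis is a quantified modulus of continuity. By it and the first moment of the
    kernel, convolution lowers [f] by at most [e + B / N.+1], and [N] is such that this is at most
    [2 * e]; adding [2 * e] makes the convolution a majorant. *)
Lemma trig_majorant f (e : R) : continuous f -> 0 < e ->
  (exists2 B, 0 <= B & forall a t, f a <= f t + e + B * (1 - cos (a - t))) ->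
  exists F : {poly R[i]}, (forall a, f a <= complex.Re F.[cis a]) /\
    complex.Re F.[0] <= (2 * pi)^-1 * cint f + 2 * e.
Proof.
move=> cf e0 [B B0 fB].
have p0 : 0 < 2 * pi :> R by rewrite mulr_gt0// pi_gt0.
pose N := Num.truncn (B / e).
have BN : B / N.+1%:R <= e.
  rewrite ler_pdivrMr// mulrC -ler_pdivrMr//; apply: ltW.
  by have /andP[_] := Num.Theory.truncn_itv (divr_ge0 B0 (ltW e0)).
have [F [F1 F2]] := cos_span_convolution (cos_span_fejer N) cf.
have [c c0 cN] := cint_fejer N.
have cgF : cint (@fejer N) = c.
  rewrite -(cN 0); congr cint; apply/funext => t.
  by rewrite /fejer sub0r cosN.
exists ((c^-1)%:C%C *: F + (2 * e)%:C%C%:P); split; last first.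
  rewrite hornerD hornerZ hornerC raddfD/= lerD2r.
  rewrite (_ : complex.Re _ = c^-1 * complex.Re F.[0]); last first.
    by case: F.[0] => x y /=; ring.
  rewrite [leRHS]mulrC ler_pdivlMr// -mulrA F2 cgF mulrC mulfK//.
  by rewrite gt_eqF.
move=> a; rewrite hornerD hornerZ hornerC raddfD/=.
rewrite (_ : complex.Re _ = c^-1 * complex.Re F.[cis a]); last first.
  by case: F.[_] => x y /=; ring.
rewrite -F1.
have ck : continuous (fun t => fejer N (a - t)) by apply: continuous_subl; exact: continuous_fejer.
have c1 : continuous (fun t => 1 - cos (a - t)).
  by move=> t; apply: cvgB; [exact: cvg_cst|apply: continuous_subl; exact: continuous_cos].
have ckc := continuous_mulfun ck c1.
have : cint (fun t => (f a - e) * fejer N (a - t) + - B * (fejer N (a - t) * (1 - cos (a - t))))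
   <= cint (fun t => f t * fejer N (a - t)).
  apply: cint_le.
  - by apply: continuous_addfun; apply: continuous_mulfun => //; exact: continuous_cst_fun.
  - exact: continuous_mulfun.
  - move=> t; have := fB a t; have := fejer_ge0 N (a - t).
    set K := fejer _ _; set d := 1 - _ => K0 h.
    have : K * f a <= K * (f t + e + B * d) by rewrite ler_wpM2l.
    lra.
rewrite cintD; do ?[by apply: continuous_mulfun => //; exact: continuous_cst_fun].
rewrite !cintZ// cN; have := cint_fejer_moment N a; rewrite cN => cm.
set I := cint _ in cm *; set J := cint _ => IJ.
have N0 : 0 < N.+1%:R :> R by [].
have eI : I = c / N.+1%:R by rewrite cm [X in X / _]mulrC mulfK// gt_eqF.
have BI : B * I <= e * c.
  by rewrite eI mulrCA mulrC ler_wpM2r// ltW.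
have : (f a - 2 * e) * c <= J by lra.
rewrite -ler_pdivlMr// [J / c]mulrC; lra.
Qed.

End trig_majorant.

(** * The topology of the complex plane through the real modulus *)

Section complex_topology.
Context {R : realType}.
Implicit Types (z w : R[i]).

Lemma normcE' z : `|z| = (normc z)%:C%C.
Proof. by case: z. Qed.

Lemma normc_ge0 z : 0 <= normc z.
Proof. by case: z => x y /=; rewrite sqrtr_ge0. Qed.

Lemma le_normcR z (r : R) : (`|z| <= r%:C%C) = (normc z <= r).
Proof. by rewrite normcE' lecR. Qed.

Lemma lt_normcR z (r : R) : (`|z| < r%:C%C) = (normc z < r).
Proof. by rewrite normcE' ltcR. Qed.

Lemma le_normc1 z : (`|z| <= 1) = (normc z <= 1).
Proof. exact: (le_normcR z 1). Qed.

Lemma normc1P z : `|z| = 1 <-> normc z = 1.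
Proof. by rewrite normcE'; split => [[]//|->]. Qed.

Lemma Re_le_normc z : `|complex.Re z| <= normc z.
Proof. by have := normc_ge_Re z; rewrite normcE' lecR. Qed.

Lemma Im_le_normc z : `|complex.Im z| <= normc z.
Proof.
case: z => x y /=; rewrite -sqrtr_sqr ler_sqrt ?addr_ge0 ?sqr_ge0//.
by rewrite lerDr sqr_ge0.
Qed.

Lemma sqr_normcE z : normc z ^+ 2 = complex.Re z ^+ 2 + complex.Im z ^+ 2.
Proof. by case: z => x y /=; rewrite sqr_sqrtr// addr_ge0 ?sqr_ge0. Qed.

Lemma nbhs_normP' (E : normedModType R[i]) (x : E) (A : set E) :
  nbhs x A <-> exists2 e : R, 0 < e & forall y, `|x - y| < e%:C%C -> A y.
Proof.
split.
  move=> /nbhs_ballP[e /= e0 eA].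
  have ee : e = (complex.Re e)%:C%C by rewrite RRe_real// gtr0_real.
  exists (complex.Re e); first by rewrite -ltcR -ee.
  by move=> y; rewrite -ee => xy; apply: eA; rewrite -ball_normE.
move=> [e e0 eA]; apply/nbhs_ballP; exists e%:C%C; first by rewrite /= ltcR.
by move=> y; rewrite -ball_normE => xy; exact: eA.
Qed.

Lemma continuous_lip (E : normedModType R[i]) (f : E -> R) (k : R) :
  (forall x y, (`|f x - f y|%:C)%C <= k%:C%C * `|x - y|) -> continuous f.
Proof.
move=> fk x A /nbhs_ballP[e /= e0 eA].
apply/nbhs_normP'; exists (e / (`|k| + 1)); first by rewrite divr_gt0// ltr_wpDl.
move=> y xy; apply: eA; rewrite -ball_normE /=.
have := fk x y; rewrite -(RRe_real (normr_real (x - y))) in xy *.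
set d := complex.Re _ in xy *; rewrite -rmorphM lecR => h.
apply: (le_lt_trans h); move: xy; rewrite ltcR ltr_pdivlMr; last by rewrite ltr_wpDl.
have d0 : 0 <= d by rewrite -lecR /d (RRe_real (normr_real _)) normr_ge0.
have := ler_norm k; set c := `|k| => kc xy; nra.
Qed.

Lemma continuous_normcB (a : R[i]) : continuous (fun z => normc (z - a)).
Proof.
apply: (@continuous_lip _ _ 1) => x y; rewrite mul1r normcE' lecR ler_norml.
have := le_normcD (x - y) (y - a); rewrite addrA subrK => h1.
have := le_normcD (y - x) (x - a); rewrite addrA subrK -[normc (y - x)]normcN opprB => h2.
by apply/andP; split; lra.
Qed.

Lemma continuous_Re : continuous (@complex.Re R).
Proof.
apply: (@continuous_lip _ _ 1) => x y; rewrite mul1r normcE' lecR.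
by apply: le_trans (Re_le_normc _); rewrite raddfB.
Qed.

Lemma continuous_complex (T : topologicalType) (f g : T -> R) (x : T) :
  {for x, continuous f} -> {for x, continuous g} ->
  {for x, continuous (fun t => (f t +i* g t)%C)}.
Proof.
move=> cf cg A /nbhs_normP'[e e0 eA].
have h1 : \forall t \near x, `|f x - f t| < e / 2.
  by move: cf => /cvgrPdist_lt/(_ (e / 2)); apply; rewrite divr_gt0.
have h2 : \forall t \near x, `|g x - g t| < e / 2.
  by move: cg => /cvgrPdist_lt/(_ (e / 2)); apply; rewrite divr_gt0.
change (\forall t \near x, A (f t +i* g t)%C).
near=> t; apply: eA; rewrite lt_normcR.
have -> : ((f x +i* g x) - (f t +i* g t))%C =
    ((f x - f t)%:C + (0 +i* (g x - g t)))%C.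
  by apply/eqP; rewrite eq_complex /= add0r addr0 !eqxx.
apply: le_lt_trans (le_normcD _ _) _ => /=.
rewrite !expr0n/= add0r addr0 !sqrtr_sqr.
have : `|f x - f t| < e / 2 by near: t.
have : `|g x - g t| < e / 2 by near: t.
lra.
Unshelve. all: by end_near. Qed.

Lemma continuous_cis : continuous (@cis R).
Proof.
by move=> t; apply: continuous_complex; [exact: continuous_cos|exact: continuous_sin].
Qed.

Lemma compact_disc (a : R[i]) (r : R) : compact [set z | normc (z - a) <= r].
Proof.
pose s := normc a + r.
have cK := compact_setX (@segment_compact R (- s) s) (@segment_compact R (- s) s).
have cf : continuous (fun p : R * R => (p.1 +i* p.2)%C).
  by move=> p; apply: continuous_complex; [exact: cvg_fst|exact: cvg_snd].
have cI := continuous_compact (continuous_subspaceT cf) cK.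
apply: subclosed_compact cI _ => /=.
  rewrite (_ : [set _ | _] = (fun z => normc (z - a)) @^-1` [set x | x <= r])//.
  apply: preimage_closed; last exact: closed_le.
  by move=> z _; exact: continuous_normcB.
move=> z /= zr; exists (complex.Re z, complex.Im z); last by case: z {zr}.
have zs : normc z <= s.
  by have := le_normcD (z - a) a; rewrite subrK /s; lra.
split => /=; rewrite in_itv/= -ler_norml.
  exact: le_trans (Re_le_normc _) zs.
exact: le_trans (Im_le_normc _) zs.
Qed.

Lemma compact_circle (a : R[i]) (r : R) : compact [set z | normc (z - a) = r].
Proof.
apply: (@subclosed_compact R[i] _ [set z | normc (z - a) <= r]);
  [|exact: compact_disc|by move=> z /= ->].
rewrite (_ : [set _ | _] = (fun z => normc (z - a)) @^-1` [set x | x = r])//.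
apply: preimage_closed; last exact: closed_eq.
by move=> z _; exact: continuous_normcB.
Qed.

End complex_topology.

(** * Polynomial majorants of upper semicontinuous functions on the circle *)

Section usc_trig_majorant.
Context {R : realType}.

Lemma usc_measurable (f : R -> \bar R) :
  (forall t (a : R), (f t < a%:E)%E -> \forall s \near t, (f s < a%:E)%E) ->
  measurable_fun setT f.
Proof.
move=> uf; rewrite (_ : f = (\- (\- f))%E); last by apply/funext => t; rewrite oppeK.
apply: measurableT_comp => //.
apply: lower_semicontinuous_measurable => t a; rewrite lteNr -EFinN => fta.
exists [set s | (f s < (- a)%:E)%E]; first exact: uf.
by move=> s /=; rewrite lteNr -EFinN.
Qed.

(** The integral of [f] may be [-oo]. The positive part is bounded by [M], so its integral is finite
    and cancels from [(M - f) + f^\+ = M + f^\-], an identity between nonnegative functions. *)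
Lemma integral_cstB d (T : measurableType d) (mu : {measure set T -> \bar R})
    (D : set T) (f : T -> \bar R) (M : R) :
  measurable D -> (mu D < +oo)%E -> measurable_fun D f -> 0 <= M ->
  (forall t, D t -> (f t <= M%:E)%E) ->
  (\int[mu]_(t in D) (M%:E - f t) = M%:E * mu D - \int[mu]_(t in D) f t)%E.
Proof.
move=> mD muD mf M0 fM.
have mp := measurable_funepos mf; have mn := measurable_funeneg mf.
have mc : measurable_fun D (fun _ : T => M%:E) by exact: measurable_cst.
have mB : measurable_fun D (fun t => M%:E - f t)%E by exact: emeasurable_funB.
have e1 : (\int[mu]_(t in D) (M%:E - f t) + \int[mu]_(t in D) (f^\+ t) =
    M%:E * mu D + \int[mu]_(t in D) (f^\- t))%E.
  rewrite -integral_cst// -!ge0_integralD//.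
  - apply: eq_integral => t /set_mem Dt; rewrite funeposE funenegE; have := fM t Dt.
    case: (f t) => [r||]//=; last first.
      by rewrite [maxe -oo%E _]max_r ?leNye// [maxe +oo%E _]max_l ?leey//= adde0.
    rewrite lee_fin -!EFin_max -!EFinD => rM; congr EFin.
    by rewrite /Order.max; case: (ltP r 0) => h1; case: (ltP (- r) 0) => h2; lra.
  - move=> t Dt; have := fM t Dt; case: (f t) => [r||]//; rewrite -?EFinB ?lee_fin ?leey//; lra.
have pfin : (\int[mu]_(t in D) (f^\+ t) \is a fin_num)%E.
  rewrite ge0_fin_numE; last exact: integral_ge0.
  apply: (@le_lt_trans _ _ (\int[mu]_(t in D) M%:E)%E).
    apply: ge0_le_integral => // t Dt.
    by rewrite funeposE ge_max fM//= lee_fin.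
  by rewrite integral_cst// lte_mul_pinfty.
rewrite [in RHS]integralE oppeB; last first.
  by rewrite fin_num_adde_defr.
rewrite addeCA addeC -e1 addeK//.
Qed.

Section regularization.
Variables (f : R[i] -> \bar R) (M : R) (z0 : R[i]) (r0 : R).
Hypotheses (fM : forall z, `|z| = 1 -> (f z <= M%:E)%E).
Hypotheses (z01 : `|z0| = 1) (fz0 : f z0 = r0%:E).

(** The sup-convolution of [f] with the cone of slope [k]: it is [k]-Lipschitz, decreases in [k],
    and tends to [f] on the circle by semicontinuity. The bound [M] and the finite value at [z0]
    make it real-valued. *)
Let reg (k : nat) (w : R[i]) : R :=
  fine (ereal_sup [set (f z - (k%:R * normc (z - w))%:E)%E | z in [set z | `|z| = 1]]).

Let reg_fin k w : ereal_sup [set (f z - (k%:R * normc (z - w))%:E)%E | z in [set z | `|z| = 1]]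
  \is a fin_num.
Proof.
set s := ereal_sup _.
have h1 : ((r0 - k%:R * normc (z0 - w))%:E <= s)%E.
  by rewrite EFinB -fz0; apply: ereal_sup_ubound; exists z0.
have h2 : (s <= M%:E)%E.
  apply: ge_ereal_sup => _ [z z1 <-].
  rewrite leeBlDr// (le_trans (fM z1))// -EFinD lee_fin lerDl.
  by rewrite mulr_ge0// normc_ge0.
by rewrite fin_numE; case: s h1 h2.
Qed.

Let reg_ge k w z : `|z| = 1 -> (f z - (k%:R * normc (z - w))%:E <= (reg k w)%:E)%E.
Proof. by move=> z1; rewrite fineK ?reg_fin//; apply: ereal_sup_ubound; exists z. Qed.

Let reg_le k w (a : R) : (forall z, `|z| = 1 -> (f z <= (a + k%:R * normc (z - w))%:E)%E) ->
  reg k w <= a.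
Proof.
move=> h; rewrite -lee_fin fineK ?reg_fin//.
by apply: ge_ereal_sup => _ [z z1 <-]; rewrite leeBlDr// -EFinD h.
Qed.

Let reg_ub k w : reg k w <= M.
Proof.
apply: reg_le => z z1; apply: le_trans (fM z1) _.
by rewrite lee_fin lerDl mulr_ge0// normc_ge0.
Qed.

Let reg_lip k w w' : reg k w <= reg k w' + k%:R * normc (w - w').
Proof.
apply: reg_le => z z1; have := reg_ge k w' z1; rewrite leeBlDr// -EFinD => /le_trans; apply.
rewrite lee_fin; have := le_normcD (z - w) (w - w'); rewrite addrA subrK => h.
have := ler_wpM2l (ler0n R k) h; rewrite mulrDr; lra.
Qed.

Let reg_anti k l w : (k <= l)%N -> reg l w <= reg k w.
Proof.
move=> kl; apply: reg_le => z z1; have := reg_ge k w z1; rewrite leeBlDr// -EFinD => /le_trans.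
apply; rewrite lee_fin lerD2l ler_wpM2r ?normc_ge0//.
by rewrite ler_nat.
Qed.

Let reg_above k w : `|w| = 1 -> (f w <= (reg k w)%:E)%E.
Proof. by move=> /(reg_ge k w); rewrite subrr Normc.normc0 mulr0 sube0. Qed.

Let reg_lim w (a : R) : usc_on [set z | `|z| = 1] f -> `|w| = 1 -> (f w < a%:E)%E ->
  exists k, reg k w <= a.
Proof.
move=> [_ uf] w1 fwa; have := uf w a w1 fwa; rewrite near_withinE.
move=> /nbhs_normP'[e e0 h].
pose k := (Num.truncn (`|M - a| / e)).+1.
have ke : M - a <= k%:R * e.
  apply: le_trans (ler_norm _) _; rewrite -ler_pdivrMr//; apply: ltW.
  by have /andP[_] := Num.Theory.truncn_itv (divr_ge0 (normr_ge0 (M - a)) (ltW e0)).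
exists k; apply: reg_le => z z1.
have k0 : 0 <= k%:R * normc (z - w) by rewrite mulr_ge0// normc_ge0.
have [ze|ze] := ltP (normc (z - w)) e.
  have : (f z < a%:E)%E by apply: h => //; rewrite lt_normcR -normcN opprB.
  by move=> /ltW/le_trans; apply; rewrite lee_fin; lra.
apply: le_trans (fM z1) _; rewrite lee_fin.
have : k%:R * e <= k%:R * normc (z - w) by rewrite ler_wpM2l.
lra.
Qed.

Let normc_cisB (s t : R) : normc (cis s - cis t) ^+ 2 = 2 * (1 - cos (s - t)).
Proof.
rewrite sqr_normcE /= cosB; have := cos2Dsin2 s; have := cos2Dsin2 t.
by rewrite !expr2; lra.
Qed.

Let reg_cis_cont k : continuous (fun t => reg k (cis t)).
Proof.
move=> t; apply/cvgrPdist_lt => e e0.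
have h := @continuous_comp _ _ _ (@cis R) (fun z => normc (z - cis t)) t
  (@continuous_cis R t) (@continuous_normcB R (cis t) (cis t)).
have e1 : 0 < e / (k%:R + 1) by rewrite divr_gt0// ltr_wpDl.
have : \forall s \near t, normc (cis s - cis t) < e / (k%:R + 1).
  have n1 : normc (cis t - cis t) < e / (k%:R + 1) by rewrite subrr Normc.normc0.
  exact: (cvgr_lt _ h _ n1).
apply: filterS => s; rewrite ltr_pdivlMr; last by rewrite ltr_wpDl.
have := reg_lip k (cis t) (cis s); have := reg_lip k (cis s) (cis t).
have -> : normc (cis t - cis s) = normc (cis s - cis t) by rewrite -normcN opprB.
have := normc_ge0 (cis s - cis t); set d := normc _ => d0 h1 h2 h3.
by rewrite ltr_norml; apply/andP; split; lra.
Qed.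

(** Monotone convergence for [M - reg k], which is nonnegative and increases to [M - f]: if all the
    means of [reg k] were at least [m], so would be that of [f]. *)
Let reg_mean (m : R) : 0 <= M -> usc_on [set z | `|z| = 1] f ->
  (circle_mean f 0%R 1%R < m%:E)%E ->
  exists k, (2 * pi)^-1 * cint (fun t => reg k (cis t)) < m.
Proof.
move=> M0 uf fm; apply: contrapT => /forallNP nk.
have p0 : 0 < 2 * pi :> R by rewrite mulr_gt0// pi_gt0.
have {}nk k : m * (2 * pi) <= cint (fun t => reg k (cis t)).
  have /negP := nk k; rewrite -leNgt mulrC => h.
  by rewrite -ler_pdivlMr.
pose D : set R := `[0, 2 * pi]%classic.
pose psi t := f (0 + 1%:C%C * cis t)%R.
have psiE t : psi t = f (cis t) by rewrite /psi add0r mul1r.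
have mD : measurable D by exact: measurable_itv.
have muD : lebesgue_measure D = (2 * pi)%:E.
  by rewrite lebesgue_measure_itv/= lte_fin p0 -EFinB subr0.
have mpsi : measurable_fun setT psi.
  apply: usc_measurable => t a; rewrite psiE => fa.
  have := uf.2 (cis t) a (normr_cis t) fa; rewrite near_withinE => h.
  have h' : \forall s \near t, `|cis s| = 1 -> (f (cis s) < a%:E)%E := @continuous_cis R t _ h.
  apply: filterS h' => s hs.
  by rewrite psiE; apply: hs; exact: normr_cis.
pose g (k : nat) (t : R) : \bar R := (M - reg k (cis t))%:E.
have mg k : measurable_fun D (g k).
  apply: (@measurable_funS _ _ _ _ setT) => //; apply/measurable_EFinP.
  apply: continuous_measurable_fun => t; apply: cvgB; [exact: cvg_cst|exact: reg_cis_cont].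
have g0 k t : D t -> (0 <= g k t)%E by rewrite lee_fin subr_ge0 reg_ub.
have gnd t : D t -> {homo g^~ t : n m / (n <= m)%N >-> (n <= m)%E}.
  by move=> _ a b ab; rewrite lee_fin lerD2l lerN2 reg_anti.
have H1 : (\int[lebesgue_measure]_(t in D) (M%:E - psi t) <=
    \int[lebesgue_measure]_(t in D) limn (g^~ t))%E.
  apply: integral_mono => t Dt.
  rewrite (cvg_lim _ (ereal_nondecreasing_cvgn (gnd t Dt)))//.
  rewrite leNgt; apply/negP => /lte_real_between[a].
  move=> h1 h2; have {}h2 : (f (cis t) < (M - a)%:E)%E.
    move: h2; rewrite psiE; case: (f (cis t)) => [r||]//; last by rewrite ltNyr.
    by rewrite -EFinB !lte_fin ltrBrDr addrC -ltrBrDr.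
  have [k rk] := reg_lim uf (normr_cis t) h2.
  have : (g k t <= ereal_sup (range (g^~ t)))%E by apply: ereal_sup_ubound; exists k.
  move=> /le_lt_trans/(_ h1); rewrite /g lte_fin {h1 h2}; clear fm; lra.
have H2 : (\int[lebesgue_measure]_(t in D) limn (g^~ t) <= ((2 * pi) * (M - m))%:E)%E.
  have := @cvg_monotone_convergence _ _ _ (@lebesgue_measure R) D mD g mg g0 gnd.
  move=> /cvg_lim <-//; apply: lime_le.
    apply: ereal_nondecreasing_is_cvgn => a b ab; apply: integral_mono => t Dt.
    exact: gnd.
  apply: nearW => k /=.
  have cM : continuous (fun _ : R => M) by exact: continuous_cst_fun.
  have c1 : continuous (fun t => -1 * reg k (cis t)).
    by apply: continuous_mulfun; [exact: continuous_cst_fun|exact: reg_cis_cont].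
  rewrite [X in (X <= _)%E](_ : _ = (cint (fun t => M + -1 * reg k (cis t)))%:E).
    rewrite (cintD cM c1) (cintZ _ (@reg_cis_cont k)) cint_cst.
    rewrite lee_fin; have := nk k; clear fm H1; lra.
  rewrite /cint /Rintegral fineK; last first.
    by apply: integrable_fin_num => //; apply: cont_integrable; exact: continuous_addfun.
  by apply: eq_integral => t _; rewrite /g mulN1r.
have := le_trans H1 H2.
rewrite integral_cstB//; last 3 first.
- by rewrite [X in (X < _)%E]muD ltry.
- exact: (@measurable_funS _ _ _ _ setT).
- by move=> t _; rewrite psiE fM// normr_cis.
move: fm; rewrite /circle_mean -/D [X in (M%:E * X)%E]muD.
set I := (X in (_ - X <= _)%E).
rewrite [X in (_ * X < _)%E](_ : _ = I)//.
case: I => [i||].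
- rewrite -EFinM lte_fin mulrC ltr_pdivrMr// => h; rewrite -EFinM -EFinB lee_fin.
  clear H1 H2; lra.
- by rewrite gt0_muley// lte_fin invr_gt0.
- by rewrite -EFinM /= leNgt ltry.
Qed.

Lemma usc_trig_majorant_bounded (m : R) : 0 <= M -> usc_on [set z | `|z| = 1] f ->
  (circle_mean f 0%R 1%R < m%:E)%E ->
  exists2 F : {poly R[i]}, (forall z, `|z| = 1 -> (f z <= (complex.Re F.[z])%:E)%E) &
    complex.Re F.[0] < m.
Proof.
move=> M0 uf /(reg_mean M0 uf)[k km].
set mu := _ * _ in km; pose e := (m - mu) / 3.
have e0 : 0 < e by rewrite divr_gt0// subr_gt0.
have [|F [F1 F2]] := @trig_majorant R (fun t => reg k (cis t)) e (@reg_cis_cont k) e0.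
  (* The Lipschitz bound becomes quadratic through [x <= e + x ^+ 2 / (4 * e)], and the squared
     chord is [2 * (1 - cos (a - t))]. *)
  exists ((2 * e)^-1 * k%:R ^+ 2); first by rewrite mulr_ge0 ?invr_ge0 ?exprn_ge0//; lra.
  move=> a t; have := reg_lip k (cis a) (cis t).
  move=> /le_trans; apply; rewrite -addrA lerD2l.
  have -> : 1 - cos (a - t) = normc (cis a - cis t) ^+ 2 / 2.
    by rewrite normc_cisB mulrC mulKf.
  set x := k%:R * normc _.
  have -> : (2 * e)^-1 * k%:R ^+ 2 * (normc (cis a - cis t) ^+ 2 / 2) = x ^+ 2 / (4 * e).
    by rewrite /x; field; rewrite gt_eqF.
  rewrite -subr_ge0 (_ : e + x ^+ 2 / (4 * e) - x = (x - 2 * e) ^+ 2 / (4 * e)).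
    by rewrite divr_ge0 ?sqr_ge0//; lra.
  by field; rewrite gt_eqF.
exists F; last by apply: le_lt_trans F2 _; rewrite -/mu /e; lra.
move=> z z1; apply: le_trans (reg_above k z1) _; rewrite lee_fin.
by have [t ->] := cis_onto z1.
Qed.

End regularization.

(** This is what turns a bound on a circle mean into a polynomial. If [f] is [-oo] on the whole
    circle a constant serves; otherwise a finite value is available for the regularisation. *)
Lemma usc_trig_majorant (f : R[i] -> \bar R) (m : R) : usc_on [set z | `|z| = 1] f ->
  (circle_mean f 0%R 1%R < m%:E)%E ->
  exists2 F : {poly R[i]}, (forall z, `|z| = 1 -> (f z <= (complex.Re F.[z])%:E)%E) &
    complex.Re F.[0] < m.
Proof.
move=> uf fm.
have [[z0 z01 fz0]|nz] := pselect (exists2 z, `|z| = 1 & f z != -oo%E); last first.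
  exists (m - 1)%:C%C%:P; last by rewrite hornerC /=; lra.
  move=> z z1; rewrite (_ : f z = -oo%E) ?leNye//.
  by apply/eqP/negP => /negP h; apply: nz; exists z.
have cK : compact [set z : R[i] | `|z| = 1].
  rewrite (_ : [set z | _] = [set z | normc (z - 0) = 1]); first exact: compact_circle.
  by apply/seteqP; split => z /=; rewrite subr0 => /normc1P.
have [M M0 fM] := usc_compact_bound cK uf.
have [r0 fr0] : exists r0, f z0 = r0%:E.
  by move: fz0 (uf.1 z0 z01); case: (f z0) => [a||]// _ _; exists a.
exact: (usc_trig_majorant_bounded fM z01 fr0).
Qed.

End usc_trig_majorant.

(** * Restriction and composition with affine lines and polynomials *)

Section comp.
Context {R : realType}.

Lemma usc_on_comp (X Y : topologicalType) (K : set X) (D : set Y) (g : X -> Y) (f : Y -> \bar R) :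
  usc_on D f -> continuous g -> (forall x, K x -> D (g x)) -> usc_on K (fun x => f (g x)).
Proof.
move=> [fy uf] cg KD; split=> [x Kx|x a Kx fa]; first exact/fy/KD.
have := uf (g x) a (KD x Kx) fa; rewrite !near_withinE => h.
have h' : \forall t \near x, D (g t) -> (f (g t) < a%:E)%E := cg x _ h.
by apply: filterS h' => t h1 Kt; apply: h1; exact: KD.
Qed.

Lemma usc_on_sub (X : topologicalType) (K D : set X) (f : X -> \bar R) :
  K `<=` D -> usc_on D f -> usc_on K f.
Proof. by move=> KD uf; apply: (@usc_on_comp _ _ K D id) => // x; exact: cvg_id. Qed.

Lemma continuous_line (E : normedModType R[i]) (x b : E) : continuous (fun z : R[i] => x + z *: b).
Proof. by move=> z; apply: (@cvgD _ _ _ (nbhs z)); [exact: cvg_cst|exact: scalel_continuous]. Qed.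

Lemma continuous_hornerC (P : {poly R[i]}) : continuous (fun z : R[i] => P.[z]).
Proof.
elim/poly_ind: P => [|P c ih] z.
  rewrite (_ : (fun z => _) = (fun=> 0)); last by apply/funext => w; rewrite horner0.
  exact: (@cvg_cst _ _ _ (nbhs z)).
rewrite (_ : (fun z => _) = (fun z => P.[z] * z + c)); last first.
  by apply/funext => w; rewrite hornerMXaddC.
apply: (@cvgD _ _ _ (nbhs z)); last exact: cvg_cst.
by apply: (@cvgM _ _ (nbhs z)); [exact: ih|exact: cvg_id].
Qed.

Lemma continuous_Re_horner (P : {poly R[i]}) : continuous (fun z : R[i] => complex.Re P.[z]).
Proof.
move=> z; apply: (@continuous_comp _ _ _ (fun z : R[i] => P.[z]) (@complex.Re R)).
  exact: continuous_hornerC.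
exact: continuous_Re.
Qed.

Lemma sqr_normcD (u v : R[i]) :
  normc (u + v) ^+ 2 = normc u ^+ 2 + 2 * complex.Re (conjc u * v) + normc v ^+ 2.
Proof. by rewrite !sqr_normcE; case: u v => [a b] [c d] /=; ring. Qed.

Lemma disc_convex (a z : R[i]) : normc (z - a) < 1 -> exists2 r : R, 0 < r &
  forall w, `|w| <= 1 -> normc (z + w * r%:C%C - a) < 1.
Proof.
move=> za; exists ((1 - normc (z - a)) / 2); first by rewrite divr_gt0// subr_gt0.
move=> w; rewrite le_normc1 => w1; set r := _ / 2.
have r0 : 0 <= r by rewrite divr_ge0// subr_ge0 ltW.
rewrite addrAC; apply: le_lt_trans (le_normcD _ _) _; rewrite normcM.
have -> : normc r%:C%C = r by rewrite /= expr0n addr0 sqrtr_sqr ger0_norm.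
have : normc w * r <= 1 * r by rewrite ler_wpM2r.
by rewrite mul1r {2}/r; move: za; set q := normc (z - a); rewrite /r -/q => za; lra.
Qed.

Lemma lee_eps (x : \bar R) (y : R) : (forall e : R, 0 < e -> (x <= (y + e)%:E)%E) -> (x <= y%:E)%E.
Proof. by move=> h; apply/lee_addgt0Pr => e e0; rewrite -EFinD h. Qed.

End comp.

(** * Harmonic majorants on discs and the disc envelope *)

Section disc_env.
Context {R : realType}.
Implicit Types (E : normedModType R[i]).

(** [weak_submean] bounds only the centre of a disc. The other points follow from the maximum
    principle with [Re P + e * (1 - |z - a|^2)], which is strictly superharmonic and equals [Re P]
    on the circle. *)
Lemma harmonic_majorant E (D : set E) (f : E -> \bar R) (x b : E) (a : R[i]) (P : {poly R[i]}) :
  usc_on D f -> weak_submean D f ->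
  (forall z, `|z - a| <= 1 -> D (x + z *: b)) ->
  (forall z, `|z - a| = 1 -> (f (x + z *: b)%R <= (complex.Re P.[z])%:E)%E) ->
  forall z, `|z - a| <= 1 -> (f (x + z *: b)%R <= (complex.Re P.[z])%:E)%E.
Proof.
move=> uf sf Db fb z za; apply: lee_eps => e e0.
pose T z := complex.Re P.[z] + e * (1 - normc (z - a) ^+ 2).
apply: (@le_trans _ _ (T z)%:E); last first.
  by rewrite lee_fin lerD2l; have := sqr_ge0 (normc (z - a)); set q := _ ^+ 2; nra.
pose K := [set z | normc (z - a) <= 1]; pose G := [set z | normc (z - a) < 1].
apply: (@max_principle R R[i] K G (fun z => f (x + z *: b)) T) => //.
- exact: compact_disc.
- by move=> w /ltW.
- apply: (@usc_on_comp _ _ _ _ _ _ f uf (@continuous_line _ _ x b)).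
  by move=> w Kw; apply: Db; rewrite le_normc1.
- move=> p c Q Gc fc.
  have := sf (x + p *: b) (c *: b) Q.
  have e1 w : x + p *: b + w *: (c *: b) = x + (p + w *: c) *: b.
    by rewrite scalerA scalerDl addrA.
  apply; move=> w w1; rewrite e1; last exact: fc.
  by apply: Db; rewrite le_normc1; apply/ltW/Gc.
- move=> w _; apply: (@cvgD _ _ _ (nbhs w)); first exact: continuous_Re_horner.
  apply: (@cvgM _ _ (nbhs w)); first exact: cvg_cst.
  apply: (@cvgB _ _ _ (nbhs w)); first exact: cvg_cst.
  by apply: (@cvgM _ _ (nbhs w)); exact: continuous_normcB.
- move=> w Kw Gw; have w1 : normc (w - a) = 1.
    by apply/eqP; rewrite eq_le Kw/= leNgt; apply/negP.
  by rewrite /T w1 expr1n subrr mulr0 addr0; apply: fb; apply/normc1P.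
- move=> p Gp; have [r r0 rG] := disc_convex Gp.
  (* For [|w| = 1], [|p - a + r w|^2] equals [|p - a|^2 + r^2] plus the real part of a linear term
     in [w]. The polynomial leaves out [r^2], whence the gain [e * r ^+ 2]. *)
  exists r%:C%C, (P \Po (p%:P + r%:C%C *: 'X) + (e * (1 - normc (p - a) ^+ 2))%:C%C%:P
     - (2 * e * r)%:C%C *: (conjc (p - a) *: 'X)), (e * r ^+ 2); first by rewrite mulr_gt0 ?exprn_gt0.
  set Q := _ - _.
  have QE w : complex.Re Q.[w] = complex.Re P.[p + w * r%:C%C] +
      e * (1 - normc (p - a) ^+ 2) - 2 * e * r * complex.Re (conjc (p - a) * w).
    rewrite /Q !hornerE /= horner_comp !hornerE /= !raddfB !raddfD /=.
    rewrite [r%:C%C * w]mulrC -[_ * _ * w]mulrA; congr (_ - _).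
    by move: ((_ - _) * w) => -[s t] /=; ring.
  split.
  + by move=> w w1; exact: rG.
  + move=> w /normc1P w1; rewrite QE /T [_ *: _]/GRing.scale /=.
    rewrite [p + _ - a]addrAC sqr_normcD normcM w1 mul1r.
    have -> : normc r%:C%C = r by rewrite /= expr0n addr0 sqrtr_sqr ger0_norm// ltW.
    have -> : complex.Re (conjc (p - a) * (w * r%:C%C)) = r * complex.Re (conjc (p - a) * w).
      by case: (conjc _) => u v; case: w {w1 QE} => s t /=; ring.
    by rewrite le_eqVlt; apply/orP; left; apply/eqP; ring.
  + by rewrite QE mul0r addr0 mulr0 /= mulr0 subr0.
- by rewrite /K /= -le_normc1.
Qed.

End disc_env.

Section disc_env.
Context {R : realType}.
Implicit Types (E : normedModType R[i]).

(** The parameter [0] corresponds to [x], so [|a| <= 1] says that [x] belongs to the closed disc. *)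
Definition disc_majorant E (D : set E) (f : E -> \bar R) (x b : E) (a : R[i]) (P : {poly R[i]}) :=
  [/\ `|a| <= 1, forall z : R[i], `|z - a| <= 1 -> D (x + z *: b) &
    forall z : R[i], `|z - a| = 1 -> (f (x + z *: b)%R <= (complex.Re P.[z])%:E)%E].

(* The discs need not be centred at [x]: this makes [disc_env] lie below the
   harmonic majorant [Re P] on the whole disc, not only at its centre. *)
Definition disc_env E (D : set E) (f : E -> \bar R) (x : E) : \bar R :=
  ereal_inf [set r | exists b a P, disc_majorant D f x b a P /\ r = (complex.Re P.[0])%:E].

(** Translating the parameter by [z] makes the same disc admissible for its point [x + z *: b]. *)
Lemma disc_env_le_disc E (D : set E) f x b a P : disc_majorant D f x b a P ->
  forall z, `|z - a| <= 1 -> (disc_env D f (x + z *: b)%R <= (complex.Re P.[z])%:E)%E.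
Proof.
move=> [a1 Db fb] z za; apply: ereal_inf_lbound; exists b, (a - z), (P \Po ('X + z%:P)).
have e w : x + z *: b + w *: b = x + (w + z) *: b by rewrite scalerDl -addrA [z *: b + _]addrC.
have e' w : w - (a - z) = w + z - a by rewrite opprB addrA.
split; last by rewrite horner_comp !hornerE ?add0r.
split=> [|w|w]; rewrite ?e'.
- by rewrite distrC.
- by rewrite e; exact: Db.
- by rewrite e horner_comp !hornerE; exact: fb.
Qed.

Lemma disc_env_le_center E (D : set E) f x b a P : disc_majorant D f x b a P ->
  (disc_env D f x <= (complex.Re P.[0])%:E)%E.
Proof. by move=> h; apply: ereal_inf_lbound; exists b, a, P. Qed.

Lemma disc_env_le E (D : set E) f x : D x -> (f x < +oo)%E -> (disc_env D f x <= f x)%E.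
Proof.
move=> Dx fx.
have h (c : R) : (f x <= c%:E)%E -> (disc_env D f x <= c%:E)%E.
  move=> fc; have -> : c%:E = (complex.Re (c%:C%C%:P).[0])%:E :> \bar R by rewrite hornerC.
  apply: (@disc_env_le_center _ _ _ _ 0 0); split=> [|z _|z _].
  - by rewrite normr0.
  - by rewrite scaler0 addr0.
  - by rewrite scaler0 addr0 hornerC.
rewrite leNgt; apply/negP => /lte_real_between[c /ltW/h + hc].
by rewrite leNgt hc.
Qed.

Lemma disc_env_ge E (D : set E) f g : usc_on D f -> weak_submean D f ->
  (forall x, D x -> (f x <= g x)%E) -> forall x, D x -> (f x <= disc_env D g x)%E.
Proof.
move=> uf sf fg x Dx; apply: le_ereal_inf_tmp => _ [b [a [P [[a1 Db gb] ->]]]].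
have := @harmonic_majorant R E D f x b a P uf sf Db _ 0.
rewrite scale0r addr0 sub0r normrN => /(_ _ a1); apply.
move=> z z1; apply: le_trans (gb z z1); apply: fg; apply: Db; by rewrite z1.
Qed.

Lemma continuous_near2 (E : normedModType R[i]) (x b : E) (z : R[i]) (A : set E) :
  nbhs (x + z *: b) A -> \forall w \near z & y \near x, A (y + w *: b).
Proof.
move=> nA.
have := @cvgD _ E _ (filter_prod (nbhs z) (nbhs x)) _ (fun p => p.2) (fun p => p.1 *: b) x (z *: b).
move=> /(_ _ _)/wrap[].
  exact: cvg_snd.
move=> /(_ _)/wrap[].
  apply: (@cvg_comp _ _ _ fst (fun w : R[i] => w *: b) _ (nbhs z)); first exact: cvg_fst.
  exact: scalel_continuous.
by move=> /(_ _ nA).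
Qed.

(** A disc and a polynomial almost optimal at [x] serve at nearby points after translating the disc
    and adding [e] to the polynomial: by compactness the translated disc stays in [D] and the bound
    persists on its circle. *)
Lemma disc_env_usc E (D : set E) f : open D -> usc_on D f -> usc_on D (disc_env D f).
Proof.
move=> oD [fy uf]; split=> [x Dx|x r Dx].
  by apply: le_lt_trans (fy x Dx); apply: disc_env_le => //; exact: fy.
move=> /ereal_inf_lt[_ [b [a [P [[a1 Db fb] ->]]]]]; rewrite lte_fin => Pr.
pose e := (r - complex.Re P.[0]) / 2.
have e0 : 0 < e by rewrite divr_gt0// subr_gt0.
have cK := @compact_disc R a 1; have cC := @compact_circle R a 1.
have h1 : \forall y \near x, [set z | normc (z - a) <= 1] `<=` (fun z => D (y + z *: b)).
  move/compact_near_coveringP: cK; apply => z /= z1.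
  apply: continuous_near2; move: oD; rewrite openE; apply; apply: Db; by rewrite le_normc1.
have h2 : \forall y \near x, [set z | normc (z - a) = 1] `<=`
    (fun z => (D (y + z *: b)%R -> f (y + z *: b)%R < (complex.Re P.[z] + e)%:E)%E).
  move/compact_near_coveringP: cC; apply => z /= /normc1P z1.
  have c1 : (f (x + z *: b)%R < (complex.Re P.[z] + e / 2)%:E)%E.
    by apply: le_lt_trans (fb z z1) _; rewrite lte_fin ltrDl divr_gt0.
  have Dz : D (x + z *: b) by apply: Db; rewrite z1.
  have := uf _ _ Dz c1; rewrite near_withinE => /continuous_near2 h.
  have c2 : \forall w \near z & y \near x, complex.Re P.[z] - e / 2 < complex.Re P.[w].
    have : \forall w \near z, complex.Re P.[z] - e / 2 < complex.Re P.[w].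
      by apply: (cvgr_gt _ (@continuous_Re_horner R P z)); rewrite ltrBlDr ltrDl divr_gt0.
    by move=> h3; exists ([set w | complex.Re P.[z] - e / 2 < complex.Re P.[w]], setT);
      [split => //; exact: filterT|move=> [w y] []].
  apply: filterS2 c2 h => -[w y] /= h3 h4 Dwy.
  by apply: lt_le_trans (h4 Dwy) _; rewrite lee_fin; clear -h3 e0; lra.
have : \forall y \near x, (disc_env D f y < r%:E)%E.
  near=> y.
  have m : disc_majorant D f y b a (P + e%:C%C%:P).
    have hD : [set z | normc (z - a) <= 1] `<=` (fun z => D (y + z *: b)) by near: y.
    split=> // [z|z z1]; first by rewrite le_normc1 => /hD.
    have Dy : D (y + z *: b) by apply: hD; rewrite /= -le_normc1 z1.
    rewrite hornerD hornerC raddfD /=; apply: ltW.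
    have : [set z | normc (z - a) = 1] `<=`
      (fun z => (D (y + z *: b)%R -> f (y + z *: b)%R < (complex.Re P.[z] + e)%:E)%E) by near: y.
    by apply => //; apply/normc1P.
  apply: le_lt_trans (disc_env_le_center m) _.
  by rewrite hornerD hornerC raddfD /= lte_fin /e; lra.
exact: cvg_within.
Unshelve. all: by end_near. Qed.

End disc_env.

(** * Iterated disc envelopes and their limit *)

Section env_lim.
Context {R : realType} (E : normedModType R[i]) (D : set E) (f : E -> \bar R).
Hypotheses (oD : open D) (uf : usc_on D f).

Definition env_iter k : E -> \bar R := iter k (disc_env D) f.

Definition env_lim (x : E) : \bar R := ereal_inf (range (env_iter ^~ x)).

Lemma env_iter_usc k : usc_on D (env_iter k).
Proof. by elim: k => [//|k ih]; exact: disc_env_usc. Qed.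

Lemma env_iterS_le k x : D x -> (env_iter k.+1 x <= env_iter k x)%E.
Proof. by move=> Dx; apply: disc_env_le => //; exact: (env_iter_usc k).1. Qed.

Lemma env_iter_le k l x : D x -> (k <= l)%N -> (env_iter l x <= env_iter k x)%E.
Proof.
move=> Dx; elim: l => [|l ih]; first by rewrite leqn0 => /eqP ->.
rewrite leq_eqVlt => /predU1P[->//|]; rewrite ltnS => /ih.
by apply: le_trans; exact: env_iterS_le.
Qed.

Lemma env_lim_le k x : (env_lim x <= env_iter k x)%E.
Proof. by apply: ereal_inf_lbound; exists k. Qed.

Lemma env_lim_lt x a : (env_lim x < a)%E -> exists k, (env_iter k x < a)%E.
Proof. by move=> /ereal_inf_lt[_ [k _ <-] ?]; exists k. Qed.

Lemma env_lim_usc : usc_on D env_lim.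
Proof.
split=> [x Dx|x a Dx /env_lim_lt[k ka]].
  exact: le_lt_trans (env_lim_le 0 x) (uf.1 x Dx).
have := (env_iter_usc k).2 x a Dx ka; rewrite !near_withinE; apply: filterS => y h Dy.
exact: le_lt_trans (env_lim_le k y) (h Dy).
Qed.

Lemma env_iter_ge (g : E -> \bar R) k : usc_on D g -> weak_submean D g ->
  (forall x, D x -> (g x <= f x)%E) -> forall x, D x -> (g x <= env_iter k x)%E.
Proof. by move=> ug sg gf; elim: k => [//|k ih]; exact: disc_env_ge. Qed.

(* Dini's argument: a majorant of the limit on a circle is, up to [e], a
   majorant of some iterate. *)
Lemma env_lim_submean : submean D env_lim.
Proof.
move=> p b Db; rewrite leNgt; apply/negP => /lte_real_between[m h1 h2].
have uc : usc_on [set z : R[i] | `|z| = 1] (fun z => env_lim (p + z *: b)).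
  apply: (@usc_on_comp _ _ _ _ _ _ env_lim env_lim_usc (@continuous_line _ _ p b)).
  by move=> z /= z1; apply: Db; rewrite z1.
have [P fP P0] := usc_trig_majorant uc h1.
pose e := m - complex.Re P.[0].
have e0 : 0 < e by rewrite subr_gt0.
have cC := @compact_circle R 0 1.
have : \forall k \near \oo, [set z | normc (z - 0) = 1] `<=`
    (fun z => env_iter k (p + z *: b)%R <= (complex.Re P.[z] + e)%:E)%E.
  move/compact_near_coveringP: cC; apply => z /=; rewrite subr0 => /normc1P z1.
  have c1 : (env_lim (p + z *: b)%R < (complex.Re P.[z] + e / 2)%:E)%E.
    by apply: le_lt_trans (fP z z1) _; rewrite lte_fin ltrDl divr_gt0.
  have [k kz] := env_lim_lt c1.
  have Dz : D (p + z *: b) by apply: Db; rewrite z1.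
  have := (env_iter_usc k).2 _ _ Dz kz; rewrite near_withinE => hk.
  have h3 : \forall w \near z, D (p + w *: b).
    by apply: (@continuous_line _ _ p b z); move: oD; rewrite openE; apply.
  have h4 : \forall w \near z, D (p + w *: b) ->
      (env_iter k (p + w *: b)%R < (complex.Re P.[z] + e / 2)%:E)%E.
    exact: (@continuous_line _ _ p b z _ hk).
  have h5 : \forall w \near z, complex.Re P.[z] - e / 2 < complex.Re P.[w].
    by apply: (cvgr_gt _ (@continuous_Re_horner R P z)); rewrite ltrBlDr ltrDl divr_gt0.
  exists ([set w | [/\ D (p + w *: b), D (p + w *: b) ->
      (env_iter k (p + w *: b)%R < (complex.Re P.[z] + e / 2)%:E)%E &
      complex.Re P.[z] - e / 2 < complex.Re P.[w]]], [set l | (k <= l)%N]).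
    split=> /=; last by exists k.
    by apply: filterS3 h3 h4 h5 => w ? ? ?; split.
  move=> [w l] [/= [Dw /(_ Dw) hw Pw] kl].
  apply: le_trans (env_iter_le Dw kl) _; apply: le_trans (ltW hw) _.
  by rewrite lee_fin; clear -Pw; lra.
case=> k _ /(_ k (leqnn k)) hk.
have m1 : disc_majorant D (env_iter k) p b 0 (P + e%:C%C%:P).
  split=> [|z|z]; rewrite ?normr0 ?subr0// => z1; first exact: Db.
  rewrite hornerD hornerC raddfD /=; apply: hk; rewrite /= subr0; exact/normc1P.
have := disc_env_le_center m1; rewrite hornerD hornerC raddfD /= addrC subrK.
move=> h; have := lt_le_trans h2 (le_trans (env_lim_le k.+1 p) h).
by rewrite ltxx.
Qed.

End env_lim.

(** * Maximality of [g (Re (F + H))] on a bidisc *)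

Section bidisc.
Context {R : realType}.

Lemma normc_real (r : R) : 0 <= r -> normc r%:C%C = r.
Proof. by move=> r0; rewrite /= expr0n addr0 sqrtr_sqr ger0_norm. Qed.

Lemma normc_eq0 (z : R[i]) : (normc z == 0) = (z == 0).
Proof. by apply/eqP/eqP => [/eq0_normc//|->]; exact: Normc.normc0. Qed.

(** The vector [(y, - x)] divided by [|x| + |y|]. Applied to the two derivatives, it gives a
    direction in which [F + H] is stationary. *)
Lemma null_direction (x y : R[i]) : exists b c : R[i],
  [/\ normc b <= 1, normc c <= 1, 0 < normc b ^+ 2 + normc c ^+ 2 & x * b + y * c = 0].
Proof.
have [x0|x0] := eqVneq x 0.
  exists 1, 0; rewrite Normc.normc1 Normc.normc0 x0 mul0r mulr0 addr0 expr1n expr0n addr0.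
  by split.
pose s := normc x + normc y.
have nx : 0 < normc x by rewrite lt_neqAle normc_ge0 andbT eq_sym normc_eq0.
have s0 : 0 < s by rewrite ltr_wpDr// normc_ge0.
have nV : normc (s^-1)%:C%C = s^-1 by rewrite normc_real// invr_ge0 ltW.
exists (y * (s^-1)%:C%C), (- x * (s^-1)%:C%C); split.
- by rewrite normcM nV ler_pdivrMr// mul1r /s lerDr ltW.
- by rewrite normcM nV normcN ler_pdivrMr// mul1r /s lerDl normc_ge0.
- by rewrite ltr_wpDl ?sqr_ge0// exprn_gt0// normcM nV normcN divr_gt0.
- by ring.
Qed.

Lemma poly_flat (Q : {poly R[i]}) : Q^`().[0] = 0 ->
  exists S : {poly R[i]}, forall z, Q.[z] = Q.[0] + z ^+ 2 * S.[z].
Proof.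
move=> Q1; exists (drop_poly 2 Q) => z.
rewrite -{1}(poly_take_drop 2 Q) hornerD hornerM hornerXn mulrC; congr (_ + _).
have q1 : Q`_1 = 0 by move: Q1; rewrite horner_coef0 coef_deriv mulr1n.
by rewrite horner_poly !big_ord_recl big_ord0 /= q1 mul0r expr0 mulr1 !addr0 horner_coef0.
Qed.

(** From [(Re s)^2 = (|s|^2 + Re (s^2)) / 2]: for constant [u], the only part of the square that is
    not the real part of a polynomial in [v] is [|v|^2 / 2]. *)
Lemma sqr_Re_add (u v : R[i]) : complex.Re (u + v) ^+ 2 =
  complex.Re (2^-1%:C%C * ((normc u ^+ 2)%:C%C + 2 * (conjc u * v) + (u + v) ^+ 2)) + normc v ^+ 2 / 2.
Proof.
rewrite !sqr_normcE; case: u v => [a b] [c d] /=.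
by rewrite !expr2 /=; field.
Qed.

Lemma horner_bounded (S : {poly R[i]}) : exists2 M : R, 0 <= M &
  forall z, normc z <= 1 -> normc S.[z] <= M.
Proof.
have cS : continuous (fun z => normc (S.[z] - 0)).
  move=> z; exact: continuous_comp (@continuous_hornerC R S z) (@continuous_normcB R 0 S.[z]).
have [M M0 SM] := continuous_compact_bound (@compact_disc R 0 1) cS.
by exists M => // z z1; rewrite -[S.[z]]subr0; apply: SM; rewrite /= subr0.
Qed.

(** A smooth majorant for [g], which need not be smooth. Close to [c] right-continuity and
    monotonicity suffice; farther to the right the parabola is steep enough to exceed the whole
    growth of [g] up to [c + S]. *)
Lemma parabola_majorant (g : R -> R) (c d S : R) : {homo g : x y / x <= y} ->
  (forall c d, 0 < d -> exists2 s, 0 < s & g (c + s) <= g c + d) -> 0 < d ->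
  exists2 N : R, 0 <= N & forall s, s <= S -> g (c + s) <= g c + d + N * s ^+ 2.
Proof.
move=> gm gr d0; have [s s0 gs] := gr c d d0.
exists (Num.max 0 ((g (c + S) - g c) / s ^+ 2)); first by rewrite le_max lexx.
set N := Num.max _ _ => t tS.
have N0 : 0 <= N by rewrite le_max lexx.
have [ts|st] := leP t s.
  have := gm (c + t) (c + s); rewrite lerD2l => /(_ ts).
  have : 0 <= N * t ^+ 2 by rewrite mulr_ge0 ?sqr_ge0.
  lra.
have := gm (c + t) (c + S); rewrite lerD2l => /(_ tS) h.
have : g (c + S) - g c <= N * s ^+ 2 by rewrite -ler_pdivrMr ?exprn_gt0// le_max lexx orbT.
have : N * s ^+ 2 <= N * t ^+ 2.
  rewrite ler_wpM2l// lerXn2r// ?nnegrE; lra.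
lra.
Qed.

(** To bound [f] at [p0], the majorant is replaced by a parabola in [L - L p0], perturbed by
    [- e * |p|^2]. On a disc of radius [rho] in a stationary direction of [F + H], the square
    [(L - L p0)^2] is harmonic up to order [rho^4], whereas the perturbation gains
    [e * rho^2 * beta]; so the result is strictly superharmonic there. *)
Lemma bidisc_max (K G : set (R[i] * R[i])) (f : R[i] * R[i] -> \bar R) (g : R -> R)
    (a a' : R[i]) (F H : {poly R[i]}) :
  `|a| <= 1 -> `|a'| <= 1 ->
  compact K -> G `<=` K -> usc_on K f -> weak_submean G f ->
  (forall p, K p -> normc (p.1 - a) <= 1 /\ normc (p.2 - a') <= 1) ->
  (forall p, G p -> exists2 r : R, 0 < r & forall b c : R[i], normc b <= r -> normc c <= r ->
     G (p.1 + b, p.2 + c)) ->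
  {homo g : x y / x <= y} ->
  (forall c d, 0 < d -> exists2 s, 0 < s & g (c + s) <= g c + d) ->
  (forall p, K p -> ~ G p -> (f p <= (g (complex.Re (F.[p.1] + H.[p.2])))%:E)%E) ->
  forall p, K p -> (f p <= (g (complex.Re (F.[p.1] + H.[p.2])))%:E)%E.
Proof.
rewrite !le_normc1 => a1 a'1 cK GK uf sf Kbd Gint gm gr bd p0 Kp0.
pose L (p : R[i] * R[i]) := complex.Re (F.[p.1] + H.[p.2]).
rewrite -/(L p0).
have cL p : {for p, continuous L}.
  have c1 : F.[q.1] @[q --> p] --> F.[p.1].
    apply: (@cvg_comp _ _ _ fst (fun z : R[i] => F.[z]) (nbhs p) (nbhs p.1)); first exact: cvg_fst.
    exact: continuous_hornerC.
  have c2 : H.[q.2] @[q --> p] --> H.[p.2].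
    apply: (@cvg_comp _ _ _ snd (fun z : R[i] => H.[z]) (nbhs p) (nbhs p.2)); first exact: cvg_snd.
    exact: continuous_hornerC.
  have c3 := @cvgD _ _ _ (nbhs p) _ _ _ _ _ c1 c2.
  apply: (@cvg_comp _ _ _ (fun q : R[i] * R[i] => F.[q.1] + H.[q.2]) (@complex.Re R)
    (nbhs p) (nbhs (F.[p.1] + H.[p.2]))); first exact: c3.
  exact: continuous_Re.
have cn (h : R[i] * R[i] -> R[i]) p : h q @[q --> p] --> h p ->
    normc (h q) ^+ 2 @[q --> p] --> normc (h p) ^+ 2.
  move=> ch.
  have c1 : normc (h q - 0) @[q --> p] --> normc (h p - 0).
    apply: (@cvg_comp _ _ _ h (fun z => normc (z - 0)) (nbhs p) (nbhs (h p))); first exact: ch.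
    exact: continuous_normcB.
  have c2 := @cvgM _ _ (nbhs p) _ _ _ _ _ c1 c1.
  have e1 : (fun q => normc (h q - 0)) \* (fun q => normc (h q - 0)) = (fun q => normc (h q) ^+ 2).
    by apply/funext => q /=; rewrite subr0 expr2.
  rewrite e1 subr0 -expr2 in c2; exact: c2.
have [S _ LS] := continuous_compact_bound cK cL.
apply: lee_eps => d d0.
have [N N0 gN] := @parabola_majorant g (L p0) (d / 2) (S - L p0) gm gr (divr_gt0 d0 (ltr0n _ 2)).
(* On [K] the squared norm is at most [8], each coordinate having modulus at most [2]; the last term
   of [T] thus lies between [0] and [8 * e = d / 2]. *)
pose e := d / 16.
have e0 : 0 < e by rewrite divr_gt0.
pose A := g (L p0) + d / 2.
pose T p := A + N * (L p - L p0) ^+ 2 + e * (8 - (normc p.1 ^+ 2 + normc p.2 ^+ 2)).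
have Kn p : K p -> normc p.1 ^+ 2 + normc p.2 ^+ 2 <= 8.
  move=> /Kbd[p1 p2].
  have := le_normcD (p.1 - a) a; rewrite subrK => h1.
  have := le_normcD (p.2 - a') a'; rewrite subrK => h2.
  have := normc_ge0 p.1; have := normc_ge0 p.2.
  clear -p1 p2 h1 h2 a1 a'1.
  have {}h1 : normc p.1 <= 2 by lra.
  have {}h2 : normc p.2 <= 2 by lra.
  set u := normc p.1 in h1 *; set v := normc p.2 in h2 * => u0 v0.
  by rewrite !expr2; nra.
apply: (@le_trans _ _ (T p0)%:E); last first.
  rewrite /T subrr expr0n mulr0 addr0 /A lee_fin.
  have := sqr_ge0 (normc p0.1); have := sqr_ge0 (normc p0.2).
  set u := _ ^+ 2; set v := _ ^+ 2 => u0 v0.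
  have : e * (8 - (u + v)) <= e * 8 by rewrite ler_pM2l//; lra.
  rewrite /e; lra.
apply: (@max_principle R _ K G f T) => //.
- move=> p _; apply: (@cvgD _ _ _ (nbhs p)).
    apply: (@cvgD _ _ _ (nbhs p)); first exact: cvg_cst.
    apply: (@cvgM _ _ (nbhs p)); first exact: cvg_cst.
    have c1 : L q - L p0 @[q --> p] --> L p - L p0.
      by apply: (@cvgB _ _ _ (nbhs p)); [exact: cL|exact: cvg_cst].
    exact: (@cvgM _ _ (nbhs p) _ _ _ _ _ c1 c1).
  apply: (@cvgM _ _ (nbhs p)); first exact: cvg_cst.
  apply: (@cvgB _ _ _ (nbhs p)); first exact: cvg_cst.
  by apply: (@cvgD _ _ _ (nbhs p)); apply: cn; [exact: cvg_fst|exact: cvg_snd].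
- move=> p Kp Gp; apply: le_trans (bd p Kp Gp) _; rewrite lee_fin -/(L p).
  have := gN (L p - L p0); rewrite lerD2r (LS p Kp) => /(_ isT).
  rewrite [L p0 + _]addrC subrK /T /A => /le_trans; apply; rewrite lerDl mulr_ge0 ?(ltW e0)//.
  by rewrite subr_ge0 Kn.
move=> [z w] Gp; have [r r0 rG] := Gint _ Gp; rewrite /= in rG.
have [b [c [b1 c1 bc0 Fb]]] := null_direction F^`().[z] H^`().[w].
pose Q := (F \Po (z%:P + b *: 'X)) + (H \Po (w%:P + c *: 'X)) - (L p0)%:C%C%:P.
have QE t : Q.[t] = F.[z + b * t] + H.[w + c * t] - (L p0)%:C%C.
  by rewrite /Q !hornerE !horner_comp !hornerE.
have [S2 QS] : exists S2 : {poly R[i]}, forall t, Q.[t] = Q.[0] + t ^+ 2 * S2.[t].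
  apply: poly_flat; rewrite /Q !poly.derivE !deriv_comp !poly.derivE !hornerE /= !horner_comp !hornerE /= ?mulr0 ?addr0 -[RHS]Fb.
  by rewrite subr0.
have [M M0 S2M] := horner_bounded S2.
set beta := normc b ^+ 2 + normc c ^+ 2 in bc0.
(* For [rho <= q] and [rho <= 1] the error [N * rho^4 * M^2 / 2] stays below the gain
   [e * rho^2 * beta]; the [+ 1] keeps the denominator positive. *)
pose q := e * beta / (N * M ^+ 2 + 1).
have NM0 : 0 < N * M ^+ 2 + 1 by rewrite ltr_wpDl// mulr_ge0// sqr_ge0.
have q0 : 0 < q by rewrite divr_gt0// mulr_gt0.
pose rho := Num.min 1 (Num.min r q).
have rho0 : 0 < rho by rewrite !lt_min r0 q0 ltr01.
have rho1 : rho <= 1 by rewrite ge_min lexx.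
have rhor : rho <= r by rewrite !ge_min lexx orbT.
have rhoq : rho <= q by rewrite !ge_min lexx !orbT.
pose phi := Q.[0].
pose Qr := Q \Po (rho%:C%C *: 'X).
(* By [sqr_Re_add] with [v = Qr - phi], [Re P1] equals [(Re Qr)^2 - |v|^2 / 2]. *)
pose P1 := 2^-1%:C%C%:P * (((normc phi ^+ 2)%:C%C)%:P + (2 * conjc phi)%:P * (Qr - phi%:P) + Qr ^+ 2).
pose P := (A + e * (8 - (normc z ^+ 2 + normc w ^+ 2)))%:C%C%:P + N%:C%C *: P1
  - ((2 * e * rho)%:C%C * (conjc z * b + conjc w * c)) *: 'X.
have QrE t : Qr.[t] = Q.[rho%:C%C * t] by rewrite /Qr horner_comp !hornerE.
have P1E t : complex.Re P1.[t] = complex.Re (2^-1%:C%C * ((normc phi ^+ 2)%:C%C +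
    2 * (conjc phi * (Qr.[t] - phi)) + (phi + (Qr.[t] - phi)) ^+ 2)).
  rewrite /P1 hornerM hornerC !hornerD horner_exp hornerM hornerD !hornerN !hornerC.
  by rewrite [phi + _]addrC subrK -mulrA.
have PE t : complex.Re P.[t] = A + e * (8 - (normc z ^+ 2 + normc w ^+ 2)) + N * complex.Re P1.[t]
    - 2 * e * rho * complex.Re ((conjc z * b + conjc w * c) * t).
  rewrite /P hornerD hornerN hornerD hornerC !hornerZ hornerX.
  rewrite !raddfB !raddfD /=; congr (_ + _ - _).
    by case: (P1.[t]) => x y /=; ring.
  rewrite -[_ * _ * t]mulrA; move: ((conjc z * b + conjc w * c) * t) => -[x y] /=; ring.
have LQ t : L (z + b * t, w + c * t) - L p0 = complex.Re Q.[t].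
  by rewrite QE /L /= raddfB.
have NX0 : 0 <= N * M ^+ 2 by rewrite mulr_ge0// sqr_ge0.
exists (rho%:C%C *: (b, c)), P, (e * rho ^+ 2 * beta - N * (rho ^+ 4 * M ^+ 2 / 2)).
  move: rhoq; rewrite /q ler_pdivlMr// => rhoq.
  have -> : e * rho ^+ 2 * beta - N * (rho ^+ 4 * M ^+ 2 / 2) =
     rho ^+ 2 * (e * beta - N * M ^+ 2 * rho ^+ 2 / 2) by field.
  rewrite mulr_gt0 ?exprn_gt0// subr_gt0.
  have : N * M ^+ 2 * rho ^+ 2 <= N * M ^+ 2 * rho.
    by rewrite ler_wpM2l// expr2 ger_pMl.
  move: rhoq NX0; set X := N * _ => rhoq X0 h.
  have : X * rho <= e * beta by apply: le_trans rhoq; rewrite mulrDr mulr1 [rho * X]mulrC lerDl ltW.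
  have := mulr_gt0 e0 bc0; lra.
split.
- move=> t; rewrite le_normc1 => t1.
  have h (u : R[i]) : normc u <= 1 -> normc (t * (rho%:C%C * u)) <= r.
    move=> u1; rewrite !normcM (normc_real (ltW rho0)); apply: (le_trans _ rhor).
    have h1 : rho * normc u <= rho by rewrite ler_piMr// ltW.
    have h2 : 0 <= rho * normc u by rewrite mulr_ge0 ?normc_ge0// ltW.
    by have := ler_pM (normc_ge0 t) h2 t1 h1; rewrite mul1r.
  by have := rG _ _ (h b b1) (h c c1).
- move=> t /normc1P t1.
  have -> : (z, w) + t *: (rho%:C%C *: (b, c)) = (z + b * (rho%:C%C * t), w + c * (rho%:C%C * t)).
    have e1 (x u : R[i]) : x + u * (rho%:C%C * t) = x + t * (rho%:C%C * u) by ring.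
    by rewrite !e1.
  rewrite PE P1E /T LQ -QrE /=.
  set v := Qr.[t] - phi.
  have vE : v = (rho%:C%C * t) ^+ 2 * S2.[rho%:C%C * t].
    by rewrite /v QrE QS /phi addrAC subrr add0r.
  have nv : normc v ^+ 2 / 2 <= rho ^+ 4 * M ^+ 2 / 2.
    have nvE : normc v = rho * rho * normc S2.[rho%:C%C * t].
      by rewrite vE normcM [(_ * t) ^+ 2]expr2 !normcM (normc_real (ltW rho0)) t1 !mulr1.
    have h : normc S2.[rho%:C%C * t] <= M.
      by apply: S2M; rewrite normcM (normc_real (ltW rho0)) t1 mulr1.
    have -> : rho ^+ 4 * M ^+ 2 = (rho * rho * M) ^+ 2 by ring.
    rewrite ler_pM2r ?invr_gt0// nvE lerXn2r ?nnegrE ?mulr_ge0 ?normc_ge0 ?(ltW rho0)//.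
    by rewrite ler_pM2l// mulr_gt0.
  have := sqr_Re_add phi v; rewrite {1}/v [phi + (_ - _)]addrC subrK => ->.
  rewrite (sqr_normcD z) (sqr_normcD w) !normcM t1 (normc_real (ltW rho0)) !mulr1.
  set X := complex.Re (2^-1%:C%C * _).
  have hc : complex.Re (conjc z * (b * (rho%:C%C * t))) + complex.Re (conjc w * (c * (rho%:C%C * t)))
     = rho * complex.Re ((conjc z * b + conjc w * c) * t).
    have hg (z1 w1 b' c' t' : R[i]) (s : R) : complex.Re (z1 * (b' * (s%:C%C * t'))) +
        complex.Re (w1 * (c' * (s%:C%C * t'))) = s * complex.Re ((z1 * b' + w1 * c') * t').
      by case: z1 w1 b' c' t' => [? ?] [? ?] [? ?] [? ?] [? ?] /=; ring.
    exact: hg.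
  have hN := ler_wpM2l N0 nv; have he := congr1 (fun x => e * x) hc.
  rewrite /= in he; move: hN he; rewrite /beta.
  set C1 := complex.Re (conjc z * _); set C2 := complex.Re (conjc w * _).
  set C := complex.Re (_ * t).
  clear; lra.
- rewrite PE P1E /T QrE mulr0 -/phi subrr.
  have := LQ 0; rewrite !mulr0 !addr0 => ->.
  have := sqr_Re_add phi 0; rewrite Normc.normc0 [0 ^+ 2]expr2 !mul0r !mulr0 !addr0 => hs.
  by rewrite subr0 -hs -/phi /=; ring.
Unshelve. all: by end_near. Qed.

End bidisc.

(** Starts the double induction, with [F] a fibre of the product. Since [l] is a coordinate along
    [B] and [F] is invariant in that direction, [e * (M - |l|^2)] is a strictly superharmonic
    perturbation along discs that stay in [F]. *)
Lemma slice_max (R : realType) (E : normedModType R[i]) (K G F : set E) (W : E -> \bar R)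
    (B : E) (l : E -> R[i]) (C : R) :
  compact K -> open G -> G `<=` K -> closed F -> usc_on K W -> weak_submean G W ->
  continuous l -> (forall p (z : R[i]), l (p + z *: B) = l p + z) ->
  (forall p (z : R[i]), F p -> F (p + z *: B)) ->
  (forall p, K p -> F p -> ~ G p -> (W p <= C%:E)%E) ->
  forall p, K p -> F p -> (W p <= C%:E)%E.
Proof.
move=> cK oG GK cF uW sW cl lB FB bd p0 Kp0 Fp0.
have cn : continuous (fun p => normc (l p - 0)).
  move=> p; apply: (@cvg_comp _ _ _ l (fun z : R[i] => normc (z - 0)) (nbhs p) (nbhs (l p))).
    exact: cl.
  exact: continuous_normcB.
have cn2 : continuous (fun p => normc (l p) ^+ 2).
  have -> : (fun p => normc (l p) ^+ 2) = (fun p => normc (l p - 0) * normc (l p - 0)).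
    by apply/funext => p; rewrite subr0 expr2.
  by move=> p; apply: (@cvgM _ _ (nbhs p)); exact: cn.
have cKF : compact (K `&` F).
  apply: (subclosed_compact _ cK); last exact: subIsetl.
  by apply: closedI => //; apply: compact_closed => //; exact: norm_hausdorff.
have [M M0 lM] := continuous_compact_bound cK cn2.
apply: lee_eps => d d0; pose e := d / (M + 1).
have e0 : 0 < e by rewrite divr_gt0// ltr_wpDl.
pose T p := C + e * (M - normc (l p) ^+ 2).
apply: (@le_trans _ _ (T p0)%:E); last first.
  have ed : e * (M + 1) = d by rewrite /e divfK// gt_eqF// ltr_wpDl.
  rewrite lee_fin /T -ed lerD2l ler_pM2l//; have := sqr_ge0 (normc (l p0)).
  by set q := _ ^+ 2; clear; lra.
apply: (@max_principle R E (K `&` F) (G `&` F) W T) => //.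
- by move=> p [/GK].
- exact: (usc_on_sub (@subIsetl _ _ _) uW).
- by move=> p b P Gb; apply: sW => z z1; have [] := Gb z z1.
- move=> p _; apply: (@cvgD _ _ _ (nbhs p)); first exact: cvg_cst.
  apply: (@cvgM _ _ (nbhs p)); first exact: cvg_cst.
  by apply: (@cvgB _ _ _ (nbhs p)); [exact: cvg_cst|exact: cn2].
- move=> p [Kp Fp] nG; apply: (@le_trans _ _ C%:E).
    by apply: bd => // Gp; apply: nG.
  by rewrite lee_fin lerDl mulr_ge0 ?(ltW e0)// subr_ge0 lM.
move=> p [Gp Fp].
have /nbhs_normP'[r0 r00 rG] : \forall z \near (0 : R[i]), G (p + z *: B).
  by apply: (@continuous_line R E p B 0); rewrite scale0r addr0; move: oG; rewrite openE; apply.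
pose r := r0 / 2; have r1 : 0 < r by rewrite divr_gt0.
exists (r%:C%C *: B), ((C + e * (M - normc (l p) ^+ 2))%:C%C%:P - ((2 * e * r)%:C%C * conjc (l p)) *: 'X),
  (e * r ^+ 2); first by rewrite mulr_gt0// exprn_gt0.
split.
- move=> z; rewrite le_normc1 => z1; rewrite scalerA; split; last exact: FB.
  apply: rG; rewrite sub0r normrN lt_normcR normcM (normc_real (ltW r1)).
  have : normc z * r <= 1 * r by rewrite ler_pM2r.
  by rewrite mul1r /r; clear -r00; lra.
- move=> z /normc1P z1; rewrite /T scalerA lB sqr_normcD normcM (normc_real (ltW r1)) z1.
  rewrite hornerD hornerN hornerC hornerZ hornerX raddfB /=.
  have -> : complex.Re ((2 * e * r)%:C%C * conjc (l p) * z) = 2 * e * complex.Re (conjc (l p) * (z * r%:C%C)).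
    by case: (conjc (l p)) => a b; case: z {z1} => c f /=; ring.
  by rewrite le_eqVlt; apply/orP; left; apply/eqP; ring.
- by rewrite hornerD hornerN hornerC hornerZ hornerX mulr0 subr0.
Unshelve. all: by end_near. Qed.

(** * Local comparison on a product by double induction *)

Section local_comparison.
Context {R : realType} (E1 E2 : normedModType R[i]).

(** What the comparison retains of a truncated [chi]: monotonicity, right-continuity at real points,
    constancy near [-oo]. *)
Definition truncated_shape (g : \bar R -> R) :=
  [/\ {homo g : x y / (x <= y)%E >-> x <= y},
    forall c d : R, 0 < d -> exists2 s : R, 0 < s & g (c + s)%:E <= g c%:E + d &
    exists m : R, forall x, (x <= m%:E)%E -> g x = g -oo%E].

(** Right-continuity settles finite [X] and [Y]. If one of them is [-oo], then [c] and [d] can be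
    chosen with [c + d = m], where [g] already has its value at [-oo]. *)
Lemma truncated_shape_inf (g : \bar R -> R) (w X Y : \bar R) : truncated_shape g ->
  (X < +oo)%E -> (Y < +oo)%E ->
  (forall c d : R, (X < c%:E)%E -> (Y < d%:E)%E -> (w <= (g (c + d)%:E)%:E)%E) ->
  (w <= (g (X + Y))%:E)%E.
Proof.
move=> [gm gr [m gNy]] Xy Yy h.
case: X Y Xy Yy h => [x||] [y||] //= _ _ h.
- apply: lee_eps => d d0; have [s s0 gs] := gr (x + y) d d0.
  apply: le_trans (h (x + s / 2) (y + s / 2) _ _) _; rewrite ?lte_fin ?ltrDl ?divr_gt0//.
  by rewrite lee_fin (_ : x + s / 2 + (y + s / 2) = x + y + s)//; field.
- apply: le_trans (h (x + 1) (m - (x + 1)) _ _) _; rewrite ?lte_fin ?ltrDl ?ltNyr//.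
  by rewrite addrCA subrr addr0 gNy.
- apply: le_trans (h (m - (y + 1)) (y + 1) _ _) _; rewrite ?lte_fin ?ltrDl ?ltNyr//.
  by rewrite subrK gNy.
- apply: le_trans (h m 0 _ _) _; rewrite ?ltNyr//.
  by rewrite addr0 gNy.
Qed.

Variables (D1 : set E1) (D2 : set E2) (u f1 : E1 -> \bar R) (v f2 : E2 -> \bar R).
Variables (K G : set (E1 * E2)) (W : E1 * E2 -> \bar R) (g : \bar R -> R).
Hypotheses (oD1 : open D1) (oD2 : open D2) (uf1 : usc_on D1 f1) (uf2 : usc_on D2 f2).
Hypotheses (uu : usc_on D1 u) (su : weak_submean D1 u) (uleF : forall x, D1 x -> (u x <= f1 x)%E).
Hypotheses (uv : usc_on D2 v) (sv : weak_submean D2 v) (vleF : forall x, D2 x -> (v x <= f2 x)%E).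
Hypotheses (cK : compact K) (GK : G `<=` K) (oG : open G).
Hypotheses (KD : forall p, K p -> D1 p.1 /\ D2 p.2).
Hypotheses (uW : usc_on K W) (sW : weak_submean G W) (gs : truncated_shape g).
Hypothesis bdW : forall p, K p -> ~ G p -> (W p <= (g (u p.1 + v p.2))%:E)%E.

(** Almost optimal discs for the two envelopes span a bidisc to which [bidisc_max] applies. At
    points outside [G] the bound is [bdW]. On the circle in [z], [k1 <= Re P] while the envelope of
    [k2] is below [Re Q], so [h1] applies; on the circle in [w], [h2] does. *)
Let step (k1 : E1 -> \bar R) (k2 : E2 -> \bar R) : usc_on D1 k1 -> usc_on D2 k2 ->
  (forall x, D1 x -> (u x <= k1 x)%E) -> (forall x, D2 x -> (v x <= k2 x)%E) ->
  (forall p, K p -> (W p <= (g (k1 p.1 + disc_env D2 k2 p.2))%:E)%E) ->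
  (forall p, K p -> (W p <= (g (disc_env D1 k1 p.1 + k2 p.2))%:E)%E) ->
  forall p, K p -> (W p <= (g (disc_env D1 k1 p.1 + disc_env D2 k2 p.2))%:E)%E.
Proof.
move=> uk1 uk2 uk vk h1 h2 [x y] Kxy /=; have [/= Dx Dy] := KD Kxy.
have [gm gr _] := gs.
apply: (truncated_shape_inf gs).
- by apply: le_lt_trans (uk1.1 x Dx); apply: disc_env_le => //; exact: uk1.1.
- by apply: le_lt_trans (uk2.1 y Dy); apply: disc_env_le => //; exact: uk2.1.
move=> c d /ereal_inf_lt[_ [b [a [P [mP ->]]]] /ltW Pc] /ereal_inf_lt[_ [b' [a' [Q [mQ ->]]]] /ltW Qd].
have [a1 Db bP] := mP; have [a'1 Db' bQ] := mQ.
pose phi (q : R[i] * R[i]) := (x + q.1 *: b, y + q.2 *: b').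
pose K2 := [set q : R[i] * R[i] | [/\ normc (q.1 - a) <= 1, normc (q.2 - a') <= 1 & K (phi q)]].
pose G2 := [set q : R[i] * R[i] | [/\ normc (q.1 - a) < 1, normc (q.2 - a') < 1 & G (phi q)]].
have cphi : continuous phi.
  move=> q; apply: (@cvg_pair _ _ _ (nbhs q)).
    apply: (@cvgD _ _ _ (nbhs q)); first exact: cvg_cst.
    apply: (@cvg_comp _ _ _ fst (fun w : R[i] => w *: b) (nbhs q) (nbhs q.1)); first exact: cvg_fst.
    exact: scalel_continuous.
  apply: (@cvgD _ _ _ (nbhs q)); first exact: cvg_cst.
  apply: (@cvg_comp _ _ _ snd (fun w : R[i] => w *: b') (nbhs q) (nbhs q.2)); first exact: cvg_snd.
  exact: scalel_continuous.
have cn1 : continuous (fun q : R[i] * R[i] => normc (q.1 - a)).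
  move=> q; apply: (@cvg_comp _ _ _ fst (fun w : R[i] => normc (w - a)) (nbhs q) (nbhs q.1)).
    exact: cvg_fst.
  exact: continuous_normcB.
have cn2 : continuous (fun q : R[i] * R[i] => normc (q.2 - a')).
  move=> q; apply: (@cvg_comp _ _ _ snd (fun w : R[i] => normc (w - a')) (nbhs q) (nbhs q.2)).
    exact: cvg_snd.
  exact: continuous_normcB.
have PE z : normc (z - a) <= 1 -> (disc_env D1 k1 (x + z *: b)%R <= (complex.Re P.[z])%:E)%E.
  by rewrite -le_normc1; exact: disc_env_le_disc.
have QE z : normc (z - a') <= 1 -> (disc_env D2 k2 (y + z *: b')%R <= (complex.Re Q.[z])%:E)%E.
  by rewrite -le_normc1; exact: disc_env_le_disc.
have := @bidisc_max R K2 G2 (fun q => W (phi q)) (fun r => g r%:E) a a' P Q a1 a'1.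
move=> /(_ _)/wrap[].
  have cX := compact_setX (@compact_disc R a 1) (@compact_disc R a' 1).
  apply: subclosed_compact cX _; last by move=> q [].
  have -> : K2 = (fun q : R[i] * R[i] => normc (q.1 - a)) @^-1` [set r | r <= 1] `&`
      ((fun q : R[i] * R[i] => normc (q.2 - a')) @^-1` [set r | r <= 1] `&` (phi @^-1` K)).
    by apply/seteqP; split=> q /= [? []] // ? ?; split.
  apply: closedI; first by apply: preimage_closed; [move=> q _; exact: cn1|exact: closed_le].
  apply: closedI; first by apply: preimage_closed; [move=> q _; exact: cn2|exact: closed_le].
  apply: preimage_closed; first by move=> q _; exact: cphi.
  by apply: compact_closed => //; exact: norm_hausdorff.
move=> /(_ _)/wrap[].
  by move=> q [/ltW ? /ltW ? /GK].
move=> /(_ _)/wrap[].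
  by apply: (@usc_on_comp _ _ _ _ _ _ W uW cphi) => q [].
move=> /(_ _)/wrap[].
  move=> p s S Gp fp.
  have e t : phi p + t *: (s.1 *: b, s.2 *: b') = phi (p + t *: s).
    by congr pair; rewrite /= scalerDl scalerA addrA.
  apply: (sW (b := (s.1 *: b, s.2 *: b'))) => t t1; rewrite e; last exact: fp.
  by have [] := Gp t t1.
move=> /(_ _)/wrap[]; first by move=> p [].
move=> /(_ _)/wrap[].
  move=> q [q1 q2 Gq].
  have : \forall t \near q, G2 t.
    near=> t; split; near: t.
    - exact: (cvgr_lt _ (cn1 q)).
    - exact: (cvgr_lt _ (cn2 q)).
    - by apply: (cphi q); move: oG; rewrite openE; apply.
  move=> /nbhs_ballP[e /= e0 eG].
  have ee : e = (complex.Re e)%:C%C by rewrite RRe_real// gtr0_real.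
  have e1 : 0 < complex.Re e by rewrite -ltcR -ee.
  exists (complex.Re e / 2); first by rewrite divr_gt0.
  move=> s t se te; apply: eG; split; rewrite /= -ball_normE /= ee opprD addrA subrr sub0r
    normrN lt_normcR; lra.
move=> /(_ _)/wrap[]; first by move=> r s rs; apply: gm; rewrite lee_fin.
move=> /(_ _)/wrap[]; first by move=> r s s0; exact: gr.
move=> /(_ _)/wrap[].
  move=> [z w] [/= za wa Kq] nG; rewrite raddfD/=.
  have [/= Dz Dw] := KD Kq.
  have [Gq|nGq] := pselect (G (phi (z, w))); last first.
    apply: le_trans (bdW Kq nGq) _; rewrite lee_fin; apply: gm; rewrite EFinD; apply: leeD.
      by apply: le_trans (PE z za); apply: disc_env_ge.
    by apply: le_trans (QE w wa); apply: disc_env_ge.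
  have [z1|z1] := ltP (normc (z - a)) 1; last first.
    apply: le_trans (h1 _ Kq) _; rewrite lee_fin; apply: gm; rewrite EFinD; apply: leeD; last exact: QE.
    by apply: bP; apply/normc1P/le_anti; rewrite za z1.
  apply: le_trans (h2 _ Kq) _; rewrite lee_fin; apply: gm; rewrite EFinD; apply: leeD; first exact: PE.
  apply: bQ; apply/normc1P/le_anti; rewrite wa /= leNgt; apply/negP => w1.
  by apply: nG; split.
move=> /(_ (0, 0) _)/wrap[].
  by split; rewrite /= ?sub0r ?normcN -?le_normc1// /phi /= !scale0r !addr0.
rewrite /phi /= !scale0r !addr0 raddfD /= => /le_trans; apply.
by rewrite lee_fin; apply: gm; rewrite lee_fin lerD.
Unshelve. all: by end_near. Qed.

Hypotheses (B1 : E1) (l1 : E1 -> R[i]) (B2 : E2) (l2 : E2 -> R[i]).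
Hypotheses (cl1 : continuous l1) (l1B : forall p (z : R[i]), l1 (p + z *: B1) = l1 p + z).
Hypotheses (cl2 : continuous l2) (l2B : forall p (z : R[i]), l2 (p + z *: B2) = l2 p + z).
Variables (C1 C2 : R).
Hypotheses (f1C : forall p, K p -> f1 p.1 = C1%:E) (f2C : forall p, K p -> f2 p.2 = C2%:E).

(** On the fibre through [p], the boundary values of [W] are at most the constant
    [g (C1 + v p.2)]. *)
Let base1 p : K p -> (W p <= (g (f1 p.1 + v p.2))%:E)%E.
Proof.
move=> Kp; rewrite (f1C Kp); have [gm _ _] := gs.
apply: (@slice_max R _ K G [set q | q.2 = p.2] W (B1, 0) (l1 \o fst)) => //.
- rewrite (_ : [set _ | _] = snd @^-1` [set p.2])//; apply: preimage_closed.
    by move=> q _; exact: cvg_snd.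
  by apply: accessible_closed_set1; exact/hausdorff_accessible/norm_hausdorff.
- move=> q; apply: (@cvg_comp _ _ _ fst l1 (nbhs q) (nbhs q.1)); first exact: cvg_fst.
  exact: cl1.
- by move=> q z; rewrite /= l1B.
- by move=> q z /= <-; rewrite scaler0 addr0.
- move=> q Kq /= qp nG; apply: le_trans (bdW Kq nG) _; rewrite lee_fin; apply: gm.
  rewrite qp; apply: leeD => //; rewrite -(f1C Kq); apply: uleF; exact: (KD Kq).1.
Qed.

Let base2 p : K p -> (W p <= (g (u p.1 + f2 p.2))%:E)%E.
Proof.
move=> Kp; rewrite (f2C Kp); have [gm _ _] := gs.
apply: (@slice_max R _ K G [set q | q.1 = p.1] W (0, B2) (l2 \o snd)) => //.
- rewrite (_ : [set _ | _] = fst @^-1` [set p.1])//; apply: preimage_closed.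
    by move=> q _; exact: cvg_fst.
  by apply: accessible_closed_set1; exact/hausdorff_accessible/norm_hausdorff.
- move=> q; apply: (@cvg_comp _ _ _ snd l2 (nbhs q) (nbhs q.2)); first exact: cvg_snd.
  exact: cl2.
- by move=> q z; rewrite /= l2B.
- by move=> q z /= <-; rewrite scaler0 addr0.
- move=> q Kq /= qp nG; apply: le_trans (bdW Kq nG) _; rewrite lee_fin; apply: gm.
  rewrite qp; apply: leeD => //; rewrite -(f2C Kq); apply: vleF; exact: (KD Kq).2.
Qed.

Let env_iters k l p : K p -> (W p <= (g (env_iter D1 f1 k p.1 + env_iter D2 f2 l p.2))%:E)%E.
Proof.
have [gm _ _] := gs.
elim: k l p => [|k ihk] l p Kp.
  apply: le_trans (base1 Kp) _; rewrite lee_fin; apply: gm; apply: leeD => //.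
  by apply: env_iter_ge => //; exact: (KD Kp).2.
elim: l p Kp => [|l ihl] p Kp.
  apply: le_trans (base2 Kp) _; rewrite lee_fin; apply: gm; apply: leeD => //.
  by apply: env_iter_ge => //; exact: (KD Kp).1.
apply: (@step (env_iter D1 f1 k) (env_iter D2 f2 l)) => //.
- exact: env_iter_usc.
- exact: env_iter_usc.
- exact: env_iter_ge.
- exact: env_iter_ge.
- by move=> q Kq; exact: (ihk l.+1 q Kq).
Qed.

Lemma local_comparison p : K p -> (W p <= (g (env_lim D1 f1 p.1 + env_lim D2 f2 p.2))%:E)%E.
Proof.
move=> Kp; have [gm _ _] := gs; have [D1p D2p] := KD Kp.
apply: (truncated_shape_inf gs).
- exact: (env_lim_usc oD1 uf1).1.
- exact: (env_lim_usc oD2 uf2).1.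
move=> c d /env_lim_lt[k kc] /env_lim_lt[l ld].
apply: le_trans (env_iters k l Kp) _; rewrite lee_fin; apply: gm.
by rewrite EFinD; apply: leeD; exact: ltW.
Qed.

End local_comparison.

(** * Real-valued norm and balls *)

Section rnorm.
Context {R : realType} {E : normedModType R[i]}.
Implicit Types x y : E.

Definition rnorm x : R := complex.Re `|x|.

Lemma rnormE x : `|x| = (rnorm x)%:C%C.
Proof. by rewrite /rnorm RRe_real// normr_real. Qed.

Lemma rnorm_ge0 x : 0 <= rnorm x.
Proof. by rewrite -lecR -rnormE normr_ge0. Qed.

Lemma rnormD x y : rnorm (x + y) <= rnorm x + rnorm y.
Proof. by rewrite -lecR rmorphD /= -!rnormE ler_normD. Qed.

Lemma rnormN x : rnorm (- x) = rnorm x.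
Proof. by rewrite /rnorm normrN. Qed.

Lemma rnormZ (z : R[i]) x : rnorm (z *: x) = normc z * rnorm x.
Proof. by rewrite /rnorm normrZ normcE' rnormE /= mul0r subr0. Qed.

Lemma continuous_rnormB (a : E) : continuous (fun x => rnorm (a - x)).
Proof.
apply: (@continuous_lip _ _ _ 1) => x y; rewrite mul1r rnormE lecR ler_norml.
have := rnormD (a - x) (x - y); rewrite addrA subrK => h1.
have := rnormD (a - y) (y - x); rewrite addrA subrK -[rnorm (y - x)]rnormN opprB => h2.
by apply/andP; split; lra.
Qed.

Lemma open_rball (a : E) (r : R) : open [set x | rnorm (a - x) < r].
Proof.
rewrite (_ : [set _ | _] = (fun x => rnorm (a - x)) @^-1` [set t | t < r])//.
by apply: open_comp; [move=> x _; exact: continuous_rnormB|exact: open_lt].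
Qed.

Lemma closed_rball (a : E) (r : R) : closed [set x | rnorm (a - x) <= r].
Proof.
rewrite (_ : [set _ | _] = (fun x => rnorm (a - x)) @^-1` [set t | t <= r])//.
by apply: preimage_closed; [move=> x _; exact: continuous_rnormB|exact: closed_le].
Qed.

Lemma rball_connected_component (a x y : E) (r : R) :
  rnorm (a - x) < r -> rnorm (a - y) < r ->
  connected_component [set t | rnorm (a - t) < r] x y.
Proof.
move=> xr yr; pose f (t : R) := x + t%:C%C *: (y - x).
have cf : continuous f.
  move=> t; apply: (@cvgD _ _ _ (nbhs t)); first exact: cvg_cst.
  apply: (@cvg_comp _ _ _ (fun t : R => t%:C%C) (fun z : R[i] => z *: (y - x)) (nbhs t) (nbhs t%:C%C)).
    by apply: (@continuous_complex R R id (fun=> 0) t); [exact: cvg_id|exact: cvg_cst].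
  exact: scalel_continuous.
have cI := connected_continuous_connected (@segment_connected R 0 1) (continuous_subspaceT cf).
have f0 : f 0 = x by rewrite /f scale0r addr0.
have f1 : f 1 = y by rewrite /f scale1r addrC subrK.
apply: (@connected_component_max _ _ (f @` `[0, 1])) => //.
- by exists 0 => //; rewrite /= in_itv /= lexx ler01.
- move=> _ [t /= + <-]; rewrite in_itv /= => /andP[t0 t1].
  have -> : a - f t = (1 - t)%:C%C *: (a - x) + t%:C%C *: (a - y).
    rewrite rmorphB scalerBl scale1r -addrA [- _ + _]addrC -scalerBr.
    have -> : a - y - (a - x) = - (y - x) by rewrite !opprB addrC addrA subrK.
    by rewrite scalerN /f opprD addrA.
  apply: le_lt_trans (rnormD _ _) _; rewrite !rnormZ !normc_real ?subr_ge0//.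
  have [->|t'] := eqVneq t 0; first by rewrite subr0 mul1r mul0r addr0.
  have {}t0 : 0 < t by rewrite lt_neqAle eq_sym t'.
  have h1 : t * rnorm (a - y) < t * r by rewrite ltr_pM2l.
  have h2 : (1 - t) * rnorm (a - x) <= (1 - t) * r by rewrite ler_wpM2l ?subr_ge0// ltW.
  lra.
- by exists 1 => //; rewrite /= in_itv /= lexx ler01.
Qed.

End rnorm.

(** * Plurisubharmonicity as a sub-mean inequality on affine discs *)

Section PSH_submean.
Context {R : realType} {N : nat}.
Local Notation V := 'rV[R[i]]_N.
Implicit Types (D G : set V) (f u : V -> \bar R).

Lemma circle_mean_line f (a b : V) (c : R[i]) (r : R) :
  circle_mean (fun z => f (a + z *: b)) c r =
  circle_mean (fun z => f (a + c *: b + z *: (r%:C%C *: b))) 0 1.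
Proof.
rewrite /circle_mean; congr (_ * _)%E; apply: eq_integral => t _; congr f.
by rewrite add0r mul1r scalerA scalerDl addrA [_ * r%:C%C]mulrC.
Qed.

Lemma PSH_submean D u : PSH D u -> submean D u.
Proof.
move=> [_ su _] p b Db; have [_ h] := su p b.
have := h 0 1 ltr01; rewrite scale0r addr0; apply.
by move=> z /=; rewrite subr0 => z1; exact: Db.
Qed.

Lemma PSH_usc D u : PSH D u -> usc_on D u.
Proof. by case. Qed.

Lemma submean_PSH D u : usc_on D u -> submean D u ->
  (forall x, D x -> exists2 y, connected_component D x y & u y != -oo%E) -> PSH D u.
Proof.
move=> uu su cu; split=> // a b; split.
  by apply: (@usc_on_comp _ _ _ _ _ _ u uu (@continuous_line _ _ a b)).
move=> c r r0 Dc; rewrite circle_mean_line; apply: su => z.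
rewrite le_normc1 => z1; rewrite scalerA -addrA -scalerDl; apply: Dc.
rewrite /= addrC addKr le_normcR normcM (normc_real (ltW r0)).
by rewrite ler_piMl// ltW.
Qed.

End PSH_submean.

(** * Envelope limits below a maximal function *)

Section MPSH_env.
Context {R : realType} {N : nat}.
Local Notation V := 'rV[R[i]]_N.
Variables (U : set V) (u : V -> \bar R) (z0 : V) (r C : R).
Hypotheses (pU : precompact U) (mU : MPSH U u) (r0 : 0 < r).

Let D := [set x | rnorm (z0 - x) < 3 * r].
Hypothesis DU : D `<=` U.
Hypothesis uC : forall x, rnorm (z0 - x) <= r -> (u x <= C%:E)%E.

Definition plug (x : V) : \bar R := if rnorm (z0 - x) <= r then C%:E else u x.

Lemma plug_ge x : (u x <= plug x)%E.
Proof. by rewrite /plug; case: ifPn => // /uC. Qed.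

(** The larger value [C] is imposed on a closed ball, so the jump is in the upper semicontinuous
    direction. *)
Lemma plug_usc : usc_on D plug.
Proof.
have [[[uy uu] _ _] _] := mU.
split=> [x Dx|x a Dx].
  by rewrite /plug; case: ifPn => _; [rewrite ltry|exact/uy/DU].
move=> px; have ux : (u x < a%:E)%E by apply: le_lt_trans px; exact: plug_ge.
have h := uu x a (DU Dx) ux; rewrite near_withinE in h.
rewrite near_withinE; move: px; rewrite {1}/plug; case: ifPn => [_ Ca|].
  apply: filterS h => y h Dy; rewrite /plug; case: ifPn => // _.
  by apply: h; exact: DU.
rewrite -ltNge => rx _.
near=> y => Dy; rewrite /plug leNgt.
have -> /= : r < rnorm (z0 - y).
  by near: y; exact: (cvgr_gt _ (@continuous_rnormB R V z0 x) _ rx).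
have h1 : U y -> (u y < a%:E)%E by near: y.
by apply: h1; exact: DU.
Unshelve. all: by end_near. Qed.

(** Outside the closed ball of radius [r], [plug] is [u], so the limit is at most [u]. This region
    contains the sphere of radius [2 * r], and maximality of [u] on the ball of that radius gives
    the rest. *)
Lemma env_lim_plug_le x : D x -> (env_lim D plug x <= u x)%E.
Proof.
move=> Dx; have [_ maxu] := mU.
have oD : open D by exact: open_rball.
have ule y : r < rnorm (z0 - y) -> (env_lim D plug y <= u y)%E.
  move=> ry; apply: le_trans (env_lim_le D plug 0 y) _.
  by rewrite /env_iter /= /plug [_ <= r]leNgt ry.
have [rx|rx] := ltP (rnorm (z0 - x)) (2 * r); last first.
  by apply: ule; apply: lt_le_trans rx; rewrite ltr_pMl// ltr1n.
pose G := [set y | rnorm (z0 - y) < 2 * r].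
have oG : open G by exact: open_rball.
have clG : closure G `<=` [set y | rnorm (z0 - y) <= 2 * r].
  by rewrite [X in _ `<=` X](closure_id _).1; [apply: closureS => y /ltW|exact: closed_rball].
have clGD : closure G `<=` D.
  by move=> y /clG /= h; apply: le_lt_trans h _; rewrite ltr_pM2r// ltr_nat.
(* A limit equal to [-oo] throughout [G] would not be in [PSH G], but then the inequality is
   trivial. *)
have [[x1 Gx1 ex1]|nx] := pselect (exists2 x1, G x1 & env_lim D plug x1 != -oo%E); last first.
  rewrite (_ : env_lim D plug x = -oo%E) ?leNye//.
  by apply/eqP/negP => /negP h; apply: nx; exists x.
have eu := env_lim_usc oD plug_usc.
have GD : G `<=` D by apply: subset_trans clGD; exact: subset_closure.
apply: (maxu G) => //.
- split; last exact: subset_trans clGD DU.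
  have := pU; rewrite !precompactE => cU; apply: (subclosed_compact _ cU); first exact: closed_closure.
  exact/closureS/(subset_trans GD DU).
- exact: (usc_on_sub clGD eu).
- apply: submean_PSH.
  + exact: (usc_on_sub GD eu).
  + by move=> p b Gb; apply: (env_lim_submean oD plug_usc) => z /Gb/GD.
  + by move=> y Gy; exists x1 => //; exact: rball_connected_component.
- move=> y [/clG /= h]; rewrite (interior_id _).1// => /negP; rewrite -leNgt => h'.
  by apply: ule; apply: lt_le_trans h'; rewrite ltr_pMl// ltr1n.
Qed.

End MPSH_env.

(** * Convex non-decreasing functions, their extension and truncation *)

Section convex_nondecreasing.
Context {R : realType} (chi : R -> R).
Hypothesis cchi : convex_function [set: convex_lmodType R^o] chi.
Hypothesis mchi : {homo chi : x y / x <= y}.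

Lemma chi_chord (x y t : R) : 0 <= t <= 1 -> chi (t * x + (1 - t) * y) <= t * chi x + (1 - t) * chi y.
Proof.
move=> /andP[t0 t1].
have := cchi (Itv01 t0 t1) (mem_set (I : [set: convex_lmodType R^o] x))
  (mem_set (I : [set: convex_lmodType R^o] y)).
by rewrite /conv /=.
Qed.

(** The chord over [[c, c + 1]] bounds the growth to the right of [c] linearly. *)
Lemma chi_right_continuous (c d : R) : 0 < d -> exists2 s, 0 < s & chi (c + s) <= chi c + d.
Proof.
move=> d0; pose L := chi (c + 1) - chi c.
have L0 : 0 <= L by rewrite subr_ge0 mchi// lerDl.
exists (Num.min 1 (d / (L + 1))); first by rewrite lt_min ltr01 divr_gt0// ltr_wpDl.
set s := Num.min _ _.
have s0 : 0 <= s by rewrite le_min ler01 divr_ge0 ?(ltW d0)// addr_ge0.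
have s1 : s <= 1 by rewrite ge_min lexx.
have sd : s * (L + 1) <= d by rewrite -ler_pdivlMr ?ltr_wpDl// ge_min lexx orbT.
have := @chi_chord (c + 1) c s; rewrite s0 s1 => /(_ isT).
rewrite (_ : s * (c + 1) + (1 - s) * c = c + s); last by ring.
by move/le_trans; apply; rewrite /L in sd; lra.
Qed.

(* The supremum of the left slopes at [c] is a slope of a supporting line. *)
Lemma chi_support (c : R) : exists2 k, 0 <= k & forall t, chi c + k * (t - c) <= chi t.
Proof.
pose sl t := (chi t - chi c) / (t - c).
have slope s t : s < c -> c < t -> sl s <= sl t.
  move=> sc ct; have cs0 : 0 < c - s by rewrite subr_gt0.
  have tc0 : 0 < t - c by rewrite subr_gt0.
  have ts0 : 0 < t - s by lra.
  have := @chi_chord s t ((t - c) / (t - s)).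
  have h1 : (t - c) / (t - s) <= 1 by rewrite ler_pdivrMr// mul1r; lra.
  rewrite h1 divr_ge0 ?(ltW tc0) ?(ltW ts0)// => /(_ isT).
  have ts1 : t - s != 0 by rewrite gt_eqF.
  rewrite (_ : _ * s + _ = c); last by field.
  rewrite (_ : 1 - (t - c) / (t - s) = (c - s) / (t - s)); last by field.
  move=> h; have {}h : chi c * (t - s) <= (t - c) * chi s + (c - s) * chi t.
    rewrite -ler_pdivlMr//; apply: le_trans h _; rewrite le_eqVlt; apply/orP; left.
    by apply/eqP; field.
  rewrite /sl -[X in X <= _]opprK -mulrN -invrN opprB -mulNr opprB ler_pdivlMr//.
  rewrite mulrAC ler_pdivrMr//; lra.
pose A := [set sl s | s in [set s | s < c]].
have A0 : A !=set0 by exists (sl (c - 1)); exists (c - 1) => //=; rewrite ltrBlDr ltrDl.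
have Aub t : c < t -> ubound A (sl t) by move=> ct _ [s sc <-]; exact: slope.
have sA : has_sup A by split => //; exists (sl (c + 1)); apply: Aub; rewrite ltrDl.
have sl0 s : s < c -> 0 <= sl s.
  move=> sc; rewrite /sl -mulrNN -invrN !opprB divr_ge0// subr_ge0 ?mchi// ltW//.
exists (sup A).
  apply: le_trans (sl0 (c - 1) _) _; first by rewrite ltrBlDr ltrDl.
  by apply: ub_le_sup; [exact: sA.2|exists (c - 1) => //=; rewrite ltrBlDr ltrDl].
move=> t; have [tc|ct|->] := ltrgtP t c; last by rewrite subrr mulr0 addr0.
  have : sl t <= sup A by apply: ub_le_sup; [exact: sA.2|exists t].
  by rewrite /sl ler_ndivrMr ?subr_lt0//; lra.
have : sup A <= sl t by apply: ge_sup => //; exact: Aub.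
by rewrite /sl ler_pdivlMr ?subr_gt0//; lra.
Qed.

Local Notation X := (extend_ninfty chi).

Lemma extend_ninftyE : X -oo%E = ereal_inf (range (fun t => (chi t)%:E)).
Proof.
rewrite /=; apply/cvg_lim => //.
set l := ereal_inf _.
have ll t : (l <= (chi t)%:E)%E by apply: ereal_inf_lbound; exists t.
have lt_near (a : \bar R) : (l < a)%E -> \forall t \near (-oo)%R, ((chi t)%:E < a)%E.
  move=> /ereal_inf_lt[_ [t0 _ <-] t0a]; exists t0; split; first exact: num_real.
  by move=> t /ltW/mchi h; apply: le_lt_trans t0a; rewrite lee_fin.
case: l ll lt_near => [l||] ll lt_near.
- apply/fine_cvgP; split; first by near=> t.
  apply/cvgrPdist_lt => e e0.
  have := lt_near (l + e)%:E; rewrite lte_fin ltrDl => /(_ e0).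
  apply: filterS => t; rewrite lte_fin => h; have := ll t; rewrite lee_fin => h'.
  by rewrite /= distrC ger0_norm ?subr_ge0//; lra.
- by have := ll 0; rewrite leNgt ltry.
- apply/cvgeNyPlt => a; exact: (lt_near a%:E (ltNyr _)).
Unshelve. all: by end_near. Qed.

Lemma extend_ninfty_lb t : (X -oo%E <= (chi t)%:E)%E.
Proof. by rewrite extend_ninftyE; apply: ereal_inf_lbound; exists t. Qed.

Lemma extend_ninfty_homo x y : (x <= y)%E -> (X x <= X y)%E.
Proof.
case: x y => [x||] [y||] //; rewrite ?leey ?lexx//.
- by rewrite !lee_fin => xy; exact: mchi.
- by move=> _; exact: extend_ninfty_lb.
Qed.

Lemma extend_ninfty_lty x : (x < +oo)%E -> (X x < +oo)%E.
Proof.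
case: x => [x||]// _; first exact: ltry.
exact: le_lt_trans (extend_ninfty_lb 0) (ltry _).
Qed.

Lemma extend_ninfty_support (c : R) : exists2 k, 0 <= k &
  forall x, (x < +oo)%E -> ((chi c - k * c)%:E + k%:E * x <= X x)%E.
Proof.
have [k k0 kc] := chi_support c; exists k => // -[t||]// _.
  by rewrite lee_fin; have := kc t; rewrite mulrBr; lra.
(* As [0 * -oo = 0] in [\bar R], slope zero requires [chi c] to be below the infimum of [chi]; a
   positive slope makes the left side [-oo]. *)
have [k1|k1] := eqVneq k 0.
  rewrite k1 mul0e adde0 mul0r subr0 extend_ninftyE.
  apply: le_ereal_inf_tmp => _ [t _ <-]; rewrite lee_fin.
  by have := kc t; rewrite k1 mul0r addr0.
by rewrite gt0_muleNy ?leNye// lte_fin lt_neqAle eq_sym k1.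
Qed.

(** A real [t > f x + h x] with [chi t < a] is split as [c + d] with [f x < c] and [h x < d], so
    that semicontinuity of each summand applies separately. *)
Lemma extend_ninfty_usc (T : topologicalType) (A : set T) (f h : T -> \bar R) :
  usc_on A f -> usc_on A h -> usc_on A (fun x => X (f x + h x)%E).
Proof.
move=> [fy uf] [hy uh]; split=> [x Ax|x a Ax].
  by apply: extend_ninfty_lty; rewrite lte_add_pinfty ?fy ?hy.
move=> Xa.
have [t fht ta] : exists2 t : R, (f x + h x < t%:E)%E & chi t < a.
  have := fy x Ax; have := hy x Ax; move: Xa.
  have XN : (X -oo < a%:E)%E -> exists2 t : R, (-oo < t%:E)%E & chi t < a.
    rewrite extend_ninftyE => /ereal_inf_lt[_ [t _ <-]]; rewrite lte_fin => ta.
    by exists t; rewrite ?ltNyr.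
  case: (f x) (h x) => [r||] [s||]// Xa _ _; try exact: XN.
  move: Xa; rewrite /= lte_fin => ra.
  have d0 : 0 < (a - chi (r + s)) / 2 by rewrite divr_gt0// subr_gt0.
  have [e e0 he] := chi_right_continuous (r + s) d0.
  exists (r + s + e); first by rewrite lte_fin ltrDl.
  by apply: le_lt_trans he _; clear -ra; lra.
have [c [d [fc hd cda]]] : exists c d : R, [/\ (f x < c%:E)%E, (h x < d%:E)%E & c + d = t].
  move: fht; have := fy x Ax; have := hy x Ax; case: (f x) (h x) => [r||] [s||]// _ _.
  - rewrite lte_fin => rst; exists (r + (t - (r + s)) / 2), (s + (t - (r + s)) / 2).
    by rewrite !lte_fin; split; clear -rst; lra.
  - by exists (r + 1), (t - (r + 1)); rewrite lte_fin ltrDl ltNyr addrC subrK.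
  - by exists (t - (s + 1)), (s + 1); rewrite lte_fin ltrDl ltNyr subrK.
  - by exists t, 0; rewrite !ltNyr addr0.
rewrite near_withinE; have := uf x c Ax fc; have := uh x d Ax hd; rewrite !near_withinE.
apply: filterS2 => y hy' fy' Ay; apply: (@le_lt_trans _ _ (chi (c + d))%:E); last by rewrite lte_fin cda.
have -> : (chi (c + d))%:E = X (c + d)%:E by [].
by apply: extend_ninfty_homo; rewrite EFinD; apply: leeD; apply: ltW; [exact: fy'|exact: hy'].
Qed.

(* The upper cut only serves to make the function real-valued and monotone on
   all of [\bar R]. *)
Definition chi_cut (m M : R) (x : \bar R) : R := chi (fine (maxe (mine x M%:E) m%:E)).

Let cut_fin (m M : R) (x : \bar R) : maxe (mine x M%:E) m%:E \is a fin_num.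
Proof.
case: x => [x||].
- by rewrite -EFin_min -EFin_max.
- by rewrite [mine +oo%E _]min_r ?leey// -EFin_max.
- by rewrite [mine -oo%E _]min_l ?leNye// max_r ?leNye.
Qed.

Lemma chi_cut_low m M x : m <= M -> (x <= m%:E)%E -> chi_cut m M x = chi m.
Proof.
move=> mM xm; rewrite /chi_cut max_r// ge_min xm.
by [].
Qed.

Lemma chi_cut_mid m M r : m <= r -> r <= M -> chi_cut m M r%:E = chi r.
Proof.
by move=> mr rM; rewrite /chi_cut min_l ?lee_fin// max_l ?lee_fin.
Qed.

Lemma chi_cut_homo m M : {homo chi_cut m M : x y / (x <= y)%E >-> x <= y}.
Proof.
move=> x y xy; apply: mchi; apply: fine_le; rewrite ?cut_fin//.
by rewrite ge_max !le_max lexx orbT andbT le_min !ge_min xy lexx !orbT.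
Qed.

Lemma chi_cut_ge_low m M x : chi m <= chi_cut m M x.
Proof.
apply: mchi; rewrite -lee_fin fineK ?cut_fin//.
by rewrite le_max lexx orbT.
Qed.

Lemma extend_ninfty_le_cut m M x : (x <= M%:E)%E -> (X x <= (chi_cut m M x)%:E)%E.
Proof.
move=> xM; rewrite /chi_cut min_l//.
have -> : (chi (fine (maxe x m%:E)))%:E = X (maxe x m%:E).
  by case: x xM => [x||]// _; [rewrite -EFin_max|rewrite max_r ?leNye].
by apply: extend_ninfty_homo; rewrite le_max lexx.
Qed.

Lemma chi_cut_shape m M : m <= M -> truncated_shape (chi_cut m M).
Proof.
move=> mM; split; first exact: chi_cut_homo.
- move=> c d d0; pose c' := Num.max (Num.min c M) m.
  have [s s0 cs] := chi_right_continuous c' d0; exists s => //.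
  rewrite /chi_cut -!EFin_min -!EFin_max /= -/c'; apply: le_trans cs; apply: mchi.
  rewrite /c' ge_max; apply/andP; split; last first.
    by apply: (@le_trans _ _ (Num.max (Num.min c M) m)); rewrite ?le_max ?lexx ?orbT// lerDl ltW.
  apply: (@le_trans _ _ (Num.min c M + s)); last by rewrite lerD2r le_max lexx.
  by rewrite /Order.min; case: (ltP (c + s) M) => h1; case: (ltP c M) => h2; lra.
- by exists m => x xm; rewrite !chi_cut_low ?leNye.
Qed.

End convex_nondecreasing.

(** * Jensen's inequality on the circle *)

Section jensen.
Context {R : realType}.
Local Notation circle := [set z : R[i] | `|z| = 1].
Local Notation D := (`[0%R, (2 * pi)%R]%classic : set R).
Let pull (f : R[i] -> \bar R) (t : R) : \bar R := f (0 + 1%:C%C * cis t)%R.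

Let p0 : 0 < 2 * pi :> R.
Proof. by rewrite mulr_gt0// pi_gt0. Qed.

Let muD : (@lebesgue_measure R) D = (2 * pi)%:E.
Proof. by rewrite lebesgue_measure_itv/= lte_fin p0 -EFinB subr0. Qed.

Let cI (f : R[i] -> \bar R) : \bar R := (\int[lebesgue_measure]_(t in D) pull f t)%E.

Let circle_meanE f : circle_mean f 0%R 1%R = (((2 * pi)^-1)%:E * cI f)%E.
Proof. by []. Qed.

Let mD : measurable D.
Proof. exact: measurable_itv. Qed.

Lemma usc_circle_bound (f : R[i] -> \bar R) : usc_on circle f ->
  exists2 M : R, 0 <= M & forall z, `|z| = 1 -> (f z <= M%:E)%E.
Proof.
move=> uf.
have cK : compact circle.
  rewrite (_ : circle = [set z | normc (z - 0) = 1]); first exact: compact_circle.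
  by apply/seteqP; split => z /=; rewrite subr0 => /normc1P.
exact: usc_compact_bound cK uf.
Qed.

Lemma usc_circle_measurable (f : R[i] -> \bar R) : usc_on circle f -> measurable_fun setT (pull f).
Proof.
move=> uf; apply: usc_measurable => t a; rewrite /pull add0r mul1r => fa.
have := uf.2 (cis t) a (normr_cis t) fa; rewrite near_withinE => h.
have h' : \forall s \near t, `|cis s| = 1 -> (f (cis s) < a%:E)%E := @continuous_cis R t _ h.
by apply: filterS h' => s hs; rewrite add0r mul1r; apply: hs; exact: normr_cis.
Qed.

(** A finite lower bound for the mean bounds the integral of [M - f], and [|f| <= (M - f) + M]. *)
Lemma usc_circle_integrable (f : R[i] -> \bar R) (c : R) : usc_on circle f ->
  (c%:E <= circle_mean f 0%R 1%R)%E -> lebesgue_measure.-integrable D (pull f).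
Proof.
move=> uf cf; have [M M0 fM] := usc_circle_bound uf.
have mf : measurable_fun D (pull f).
  exact: (@measurable_funS _ _ _ _ setT) (usc_circle_measurable uf).
have pM t : D t -> (pull f t <= M%:E)%E.
  by move=> _; rewrite /pull add0r mul1r; apply: fM; exact: normr_cis.
have mB : measurable_fun D (fun t => M%:E - pull f t)%E by exact: emeasurable_funB.
have B0 t : D t -> (0 <= M%:E - pull f t)%E.
  by move=> /pM; case: (pull f t) => [r||]//; rewrite ?leey// -EFinB !lee_fin; lra.
apply/integrableP; split => //.
have Bfin : (\int[lebesgue_measure]_(t in D) (M%:E - pull f t) < +oo)%E.
  have -> : (\int[lebesgue_measure]_(t in D) (M%:E - pull f t) = M%:E * (2 * pi)%:E - cI f)%E.
    by rewrite integral_cstB//; [congr (_ * _ - _)%E; exact: muD|rewrite [X in (X < _)%E]muD ltry].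
  move: cf; rewrite circle_meanE; case: (cI f) => [i||] //; rewrite ?ltry//.
  by rewrite gt0_muleNy ?lte_fin ?invr_gt0// leeNy_eq.
apply: (@le_lt_trans _ _ (\int[lebesgue_measure]_(t in D) ((M%:E - pull f t) + M%:E))%E).
  apply: integral_mono => t Dt; have := pM t Dt; case: (pull f t) => [r||]//= rM.
  rewrite lee_fin ler_norml; move: rM; rewrite lee_fin => rM; apply/andP; split; lra.
rewrite ge0_integralD// integral_cst// lte_add_pinfty//.
by rewrite [X in (_ * X < _)%E]muD -EFinM ltry.
Qed.

(** The integrated form of a supporting line [A + s * x] below [k]. The finite lower bounds make [f]
    and [h] integrable, so that the mean of the affine expression splits. *)
Lemma circle_mean_affine (f h k : R[i] -> \bar R) (c d A s : R) :
  usc_on circle f -> usc_on circle h ->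
  (c%:E <= circle_mean f 0%R 1%R)%E -> (d%:E <= circle_mean h 0%R 1%R)%E -> 0 <= s ->
  (forall z, `|z| = 1 -> (A%:E + s%:E * (f z + h z) <= k z)%E) ->
  ((A + s * (c + d))%:E <= circle_mean k 0%R 1%R)%E.
Proof.
move=> uf uh cf dh s0 fhk.
have If := usc_circle_integrable uf cf; have Ih := usc_circle_integrable uh dh.
pose g z := (A%:E + s%:E * (f z + h z))%E.
apply: (@le_trans _ _ (circle_mean g 0 1)); last first.
  by apply: circle_mean_le => t; rewrite add0r mul1r; apply: fhk; exact: normr_cis.
have Ic : lebesgue_measure.-integrable D (fun _ : R => A%:E).
  by apply: cont_integrable; exact: continuous_cst_fun.
have gE : (cI g = (A * (2 * pi))%:E + s%:E * (cI f + cI h))%E.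
  rewrite /cI /g /pull integralD//=; last by apply: integrableZl => //; exact: integrableD.
  rewrite integralZl//; last exact: integrableD.
  rewrite integralD//= integral_cst// EFinM; congr (_ * _ + _)%E; exact: muD.
move: cf dh; rewrite !circle_meanE gE.
have : cI f \is a fin_num by exact: integrable_fin_num.
have : cI h \is a fin_num by exact: integrable_fin_num.
case: (cI h) => [i||]//; case: (cI f) => [j||]// _ _.
move=> cj di; suff : A + s * (c + d) <= (2 * pi)^-1 * (A * (2 * pi) + s * (j + i)) by rewrite -lee_fin.
move: cj di; rewrite -!EFinM !lee_fin ![(2 * pi)^-1 * _]mulrC !ler_pdivlMr// => cj di.
by rewrite mulrDl lerD2l -mulrA ler_wpM2l// mulrDl lerD.
Qed.

End jensen.

(** * Pairs as row vectors *)

Section row_mx_topology.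
Context {R : realType} {n : nat}.
Local Notation V := 'rV[R[i]]_n.
Local Notation W := 'rV[R[i]]_(n + n).

Lemma continuous_row_mx : continuous (fun p : V * V => row_mx p.1 p.2 : W).
Proof.
move=> x A /nbhs_ballP[e e0 eA]; apply/nbhs_ballP; exists e => // y [[_ xy1] [_ xy2]].
apply: eA; split=> // i j; rewrite !mxE; case: (fintype.split j) => k; [exact: xy1|exact: xy2].
Qed.

Lemma lsubmx_line (p b : W) (z : R[i]) : lsubmx (p + z *: b) = lsubmx p + z *: lsubmx b :> V.
Proof. by apply/matrixP => i j; rewrite !mxE. Qed.

Lemma rsubmx_line (p b : W) (z : R[i]) : rsubmx (p + z *: b) = rsubmx p + z *: rsubmx b :> V.
Proof. by apply/matrixP => i j; rewrite !mxE. Qed.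

Lemma row_mx_line (x y b c : V) (z : R[i]) :
  row_mx (x + z *: b) (y + z *: c) = row_mx x y + z *: row_mx b c :> W.
Proof. by rewrite scale_row_mx add_row_mx. Qed.

(** [(x, y)] is joined to [(x', y)] in a copy of [A], then to [(x', y')] in a copy of [B]. *)
Lemma cprod_component (A B : set V) (x x' y y' : V) : connected A -> connected B ->
  A x -> A x' -> B y -> B y' ->
  connected_component (cprod A B) (row_mx x y) (row_mx x' y').
Proof.
move=> cA cB Ax Ax' By By'.
have c1 : continuous (fun t : V => row_mx t y : W).
  move=> t A0 /nbhs_ballP[e e0 eA]; apply/nbhs_ballP; exists e => // s [_ ts]; apply: eA.
  by split=> // i j; rewrite !mxE; case: (fintype.split j) => k; [exact: ts|exact: ballxx].
have c2 : continuous (fun t : V => row_mx x' t : W).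
  move=> t A0 /nbhs_ballP[e e0 eA]; apply/nbhs_ballP; exists e => // s [_ ts]; apply: eA.
  by split=> // i j; rewrite !mxE; case: (fintype.split j) => k; [exact: ballxx|exact: ts].
have k1 := connected_continuous_connected cA (continuous_subspaceT c1).
have k2 := connected_continuous_connected cB (continuous_subspaceT c2).
apply: (@connected_component_trans _ _ (row_mx x' y)).
  apply: (connected_component_max (B := (fun t : V => row_mx t y : W) @` A)) => //.
  - by exists x.
  - by move=> _ [t At <-]; rewrite /cprod /= row_mxKl row_mxKr.
  - by exists x'.
apply: (connected_component_max (B := (fun t : V => row_mx x' t : W) @` B)) => //.
- by exists y.
- by move=> _ [t Bt <-]; rewrite /cprod /= row_mxKl row_mxKr.
- by exists y'.
Qed.

End row_mx_topology.

(** * Plurisubharmonicity of [chi (u + v)] *)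

Section PSH_chi_sum.
Context {R : realType} {n : nat} (chi : R -> R).
Local Notation V := 'rV[R[i]]_n.
Local Notation W := 'rV[R[i]]_(n + n).
Variables (Omega : set V) (u v : V -> \bar R).
Hypothesis cchi : convex_function [set: convex_lmodType R^o] chi.
Hypothesis mchi : {homo chi : x y / x <= y}.
Hypotheses (cO : connected Omega) (pu : PSH Omega u) (pv : PSH Omega v).
Local Notation X := (extend_ninfty chi).

Lemma chi_sum_usc : usc_on (cprod Omega Omega) (chi_sum chi u v).
Proof.
apply: (extend_ninfty_usc cchi mchi).
- by apply: (@usc_on_comp _ _ _ _ _ _ u (PSH_usc pu) (@continuous_lsubmx R[i] 1 n n)) => x [].
- by apply: (@usc_on_comp _ _ _ _ _ _ v (PSH_usc pv) (@continuous_rsubmx R[i] 1 n n)) => x [].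
Qed.

Lemma circle_mean_ge (f : R[i] -> \bar R) (c : R) :
  (forall z, `|z| = 1 -> (c%:E <= f z)%E) -> (c%:E <= circle_mean f 0%R 1%R)%E.
Proof.
move=> cf; have := @circle_mean_cont R (fun=> c%:E) (fun=> c) 0 1.
rewrite cint_cst => /(_ (@continuous_cst_fun R c)).
move=> /(_ _)/wrap[] // e.
apply: (@le_trans _ _ (circle_mean (fun=> c%:E) 0 1)).
  by rewrite e mulrC mulfK// gt_eqF// mulr_gt0// pi_gt0.
by apply: circle_mean_le => t; rewrite add0r mul1r; apply: cf; exact: normr_cis.
Qed.

(** If both central values are finite, this is Jensen's inequality for the supporting line of [chi]
    at [c + d]. Otherwise the central value is [X -oo], the least value of [X]. *)
Lemma chi_sum_submean : submean (cprod Omega Omega) (chi_sum chi u v).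
Proof.
move=> p b Db.
pose f z := u (lsubmx p + z *: lsubmx b); pose h z := v (rsubmx p + z *: rsubmx b).
have Du z : `|z| <= 1 -> Omega (lsubmx p + z *: lsubmx b).
  by move=> /Db[]; rewrite lsubmx_line.
have Dv z : `|z| <= 1 -> Omega (rsubmx p + z *: rsubmx b).
  by move=> /Db[]; rewrite rsubmx_line.
have Dp : Omega (lsubmx p) by have := Du 0; rewrite normr0 ler01 scale0r addr0 => /(_ isT).
have Dq : Omega (rsubmx p) by have := Dv 0; rewrite normr0 ler01 scale0r addr0 => /(_ isT).
have uf : usc_on [set z : R[i] | `|z| = 1] f.
  apply: (@usc_on_comp _ _ _ _ _ _ u (PSH_usc pu) (@continuous_line _ _ (lsubmx p) (lsubmx b))).
  by move=> z /= z1; apply: Du; rewrite z1.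
have uh : usc_on [set z : R[i] | `|z| = 1] h.
  apply: (@usc_on_comp _ _ _ _ _ _ v (PSH_usc pv) (@continuous_line _ _ (rsubmx p) (rsubmx b))).
  by move=> z /= z1; apply: Dv; rewrite z1.
have mf : (u (lsubmx p) <= circle_mean f 0%R 1%R)%E by exact: (PSH_submean pu Du).
have mh : (v (rsubmx p) <= circle_mean h 0%R 1%R)%E by exact: (PSH_submean pv Dv).
have kE z : chi_sum chi u v (p + z *: b)%R = X (f z + h z)%E.
  by rewrite /chi_sum lsubmx_line rsubmx_line.
have fh z : `|z| = 1 -> (f z + h z < +oo)%E.
  by move=> z1; rewrite lte_add_pinfty ?(uf.1 z) ?(uh.1 z).
have bot : (X -oo <= circle_mean (fun z => chi_sum chi u v (p + z *: b)%R) 0%R 1%R)%E.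
  case e : (X -oo) => [c||]; last by rewrite leNye.
    apply: circle_mean_ge => z z1; rewrite kE -e.
    exact: (extend_ninfty_homo mchi (leNye _)).
  by have := extend_ninfty_lb mchi 0; rewrite e leNgt ltry.
have := (PSH_usc pu).1 _ Dp; have := (PSH_usc pv).1 _ Dq.
rewrite {1}/chi_sum; case ec : (u (lsubmx p)) mf => [c||] mf; case ed : (v (rsubmx p)) mh => [d||] mh // _ _.
have [k k0 kX] := extend_ninfty_support cchi mchi (c + d).
have := circle_mean_affine uf uh mf mh k0 (k := (fun z => chi_sum chi u v (p + z *: b)%R))
   (A := chi (c + d) - k * (c + d)).
rewrite subrK; apply => z z1; rewrite kE; exact/kX/fh.
Qed.

Lemma PSH_chi_sum : PSH (cprod Omega Omega) (chi_sum chi u v).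
Proof.
apply: submean_PSH; [exact: chi_sum_usc|exact: chi_sum_submean|].
move=> x [xl xr]; have [y1 c1 uy1] : exists2 y, Omega y & u y != -oo%E.
  have [_ _ /(_ _ xl)[y cy uy]] := pu; exists y => //; exact: connected_component_sub cy.
have [y2 c2 vy2] : exists2 y, Omega y & v y != -oo%E.
  have [_ _ /(_ _ xr)[y cy uy]] := pv; exists y => //; exact: connected_component_sub cy.
exists (row_mx y1 y2); first by rewrite -[x]hsubmxK; exact: cprod_component.
rewrite /chi_sum row_mxKl row_mxKr.
have := (PSH_usc pu).1 _ c1; have := (PSH_usc pv).1 _ c2.
by case: (u y1) uy1 => [?||]//; case: (v y2) vy2.
Qed.

End PSH_chi_sum.

(** * The squared Euclidean norm *)

Section sqnorm.
Context {R : realType} {n : nat}.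
Implicit Types x y : 'rV[R[i]]_n.

Definition sqnorm x : R := \sum_i normc (x 0 i) ^+ 2.

Lemma sqnorm_ge0 x : 0 <= sqnorm x.
Proof. by apply: sumr_ge0 => i _; exact: sqr_ge0. Qed.

(** The right side is the real part of an affine function of [x]; adding a multiple of it therefore
    preserves [weak_submean], which is how [sqnorm] enters the globalisation. *)
Lemma sqnormB x y : sqnorm x - sqnorm (x - y) =
  2 * complex.Re (\sum_i conjc (y 0 i) * x 0 i) - sqnorm y.
Proof.
have -> : complex.Re (\sum_i conjc (y 0 i) * x 0 i) = \sum_i complex.Re (conjc (y 0 i) * x 0 i).
  by rewrite raddf_sum.
rewrite /sqnorm mulr_sumr -!sumrB; apply: eq_bigr => i _.
rewrite !mxE !sqr_normcE; case: (x 0 i) (y 0 i) => [a b] [c d] /=; ring.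
Qed.

Lemma rnorm_le_sqnorm x : rnorm x ^+ 2 <= sqnorm x.
Proof.
have [->|x0] := eqVneq x 0.
  by rewrite /rnorm normr0 /= expr0n sqnorm_ge0.
have : mx_norm x != 0 by apply: contra_neq x0 => /mx_norm_eq0.
move=> /mx_norm_neq0[[i j] xij].
have -> : rnorm x = normc (x 0 j).
  apply: complexI; rewrite -rnormE -normcE' /Num.norm /= xij /=.
  by rewrite (ord1 i).
rewrite /sqnorm (bigD1 j)//= lerDl.
by apply: sumr_ge0 => k _; exact: sqr_ge0.
Qed.

Lemma continuous_sqnorm : continuous sqnorm.
Proof.
move=> x; rewrite /sqnorm.
have h (i : 'I_n) : continuous (fun y : 'rV[R[i]]_n => normc (y 0 i) ^+ 2).
  move=> y.
  have c1 : normc (z 0 i - 0) @[z --> y] --> normc (y 0 i - 0).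
    apply: (@cvg_comp _ _ _ (fun z : 'rV[R[i]]_n => z 0 i) (fun w => normc (w - 0)) (nbhs y) (nbhs (y 0 i))).
      exact: coord_continuous.
    exact: continuous_normcB.
  have c2 := @cvgM _ _ (nbhs y) _ _ _ _ _ c1 c1.
  have e1 : (fun z : 'rV[R[i]]_n => normc (z 0 i - 0)) \* (fun z : 'rV[R[i]]_n => normc (z 0 i - 0)) =
      (fun z => normc (z 0 i) ^+ 2).
    by apply/funext => z /=; rewrite subr0 expr2.
  rewrite e1 subr0 -expr2 in c2; exact: c2.
elim: (index_enum _) => [|i s ih].
  rewrite (_ : (fun _ => _) = (fun=> 0)); first exact: (@cvg_cst _ _ _ (nbhs x)).
  by apply/funext => y; rewrite big_nil.
rewrite (_ : (fun _ => _) = (fun y : 'rV[R[i]]_n => normc (y 0 i) ^+ 2 + \sum_(j <- s) normc (y 0 j) ^+ 2)).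
  by apply: (@cvgD _ _ _ (nbhs x)); [exact: h|exact: ih].
by apply/funext => y; rewrite big_cons.
Qed.

End sqnorm.

Lemma sqnorm_row_mx (R : realType) (n : nat) (x y : 'rV[R[i]]_n) :
  sqnorm (row_mx x y) = sqnorm x + sqnorm y.
Proof.
rewrite /sqnorm big_split_ord /=; congr (_ + _); apply: eq_bigr => i _.
  by rewrite row_mxEl.
by rewrite row_mxEr.
Qed.

(** * A uniform radius of local maximality *)

Section uniform_radius.
Context {R : realType} {n : nat}.
Local Notation V := 'rV[R[i]]_n.

(** The factor [3] leaves room for the spheres of radius [r] and [2 * r] used with [plug]. *)
Definition good_ball (u : V -> \bar R) (z : V) (r : R) := exists U : set V,
  [/\ precompact U, MPSH U u & [set y | rnorm (z - y) < 3 * r] `<=` U].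

Lemma good_ball_near (D : set V) (u : V -> \bar R) (z : V) : MPSH_loc D u -> D z ->
  exists2 r : R, 0 < r & forall y s, rnorm (z - y) < r -> s < r -> good_ball u y s.
Proof.
move=> [_ h] /h[U [oU Uz [pU _] mU]].
have : nbhs z U by move: oU; rewrite openE; apply.
(* One quarter of [e] is spent on moving the centre, three on the ball of radius [3 * s]. *)
move=> /nbhs_normP'[e e0 eU]; exists (e / 4); first by rewrite divr_gt0.
move=> y s zy se; exists U; split=> // w /= yw; apply: eU; rewrite rnormE ltcR.
have := rnormD (z - y) (y - w); rewrite addrA subrK; lra.
Qed.

Lemma good_ball_bound (u : V -> \bar R) (z : V) (r : R) : 0 < r -> good_ball u z r ->
  exists C : R, forall y, rnorm (z - y) <= r -> (u y <= C%:E)%E.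
Proof.
move=> r0 [U [pU mU sU]]; rewrite precompactE in pU.
pose B := [set y | rnorm (z - y) <= r].
have BU : B `<=` U by move=> y /= h; apply: sU; apply: le_lt_trans h _; rewrite ltr_pMl// ltr1n.
have cB : compact B.
  apply: (subclosed_compact _ pU); first exact: closed_rball.
  by move=> y /BU; exact: subset_closure.
have [M _ uM] := usc_compact_bound cB (usc_on_sub BU (PSH_usc mU.1)).
by exists M.
Qed.

End uniform_radius.

Lemma uniform_good_ball (R : realType) (n : nat) (D : set 'rV[R[i]]_n)
    (u v : 'rV[R[i]]_n -> \bar R) (K : set 'rV[R[i]]_(n + n)) :
  MPSH_loc D u -> MPSH_loc D v -> compact K -> K `<=` cprod D D ->
  exists2 r : R, 0 < r & forall x, K x -> good_ball u (lsubmx x) r /\ good_ball v (rsubmx x) r.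
Proof.
move=> lu lv cK KD.
have : \forall r \near (0 : R)^'+, K `<=` (fun x => good_ball u (lsubmx x) r /\ good_ball v (rsubmx x) r).
  move/compact_near_coveringP: cK; apply => x Kx; have [Dl Dr] := KD x Kx.
  have [r1 r10 h1] := good_ball_near lu Dl; have [r2 r20 h2] := good_ball_near lv Dr.
  exists ([set y | rnorm (lsubmx x - lsubmx y) < r1 /\ rnorm (rsubmx x - rsubmx y) < r2],
      [set s | s < r1 /\ s < r2]).
    split=> /=.
      have c1 : \forall y \near lsubmx x, rnorm (lsubmx x - y) < r1.
        by apply/nbhs_normP'; exists r1 => // y; rewrite rnormE ltcR.
      have c2 : \forall y \near rsubmx x, rnorm (rsubmx x - y) < r2.
        by apply/nbhs_normP'; exists r2 => // y; rewrite rnormE ltcR.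
      have d1 := @continuous_lsubmx R[i] 1 n n x _ c1; have d2 := @continuous_rsubmx R[i] 1 n n x _ c2.
      by apply: filterI; [exact: d1|exact: d2].
    by near=> s; split; near: s; exact: nbhs_right_lt.
  by move=> [y s] [/= [hy1 hy2] [s1 s2]]; split; [exact: h1|exact: h2].
move=> /(filterI (nbhs_right_gt 0)) /filter_ex[r [r0 hr]].
by exists r.
Unshelve. all: by end_near. Qed.

(** * Comparison on a box of fixed radius *)

Section box.
Context {R : realType} {n : nat}.
Local Notation V := 'rV[R[i]]_n.+1.
Local Notation W := 'rV[R[i]]_(n.+1 + n.+1).

(** [local_comparison], transported to row vectors and started from [plug]; [env_lim_plug_le]
    replaces the resulting limits by [u] and [v]. *)
Lemma box_comparison (u v : V -> \bar R) (a b : V) (r : R) (g : \bar R -> R)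
    (K G : set W) (f : W -> \bar R) :
  0 < r -> good_ball u a r -> good_ball v b r -> truncated_shape g ->
  compact K -> open G -> G `<=` K ->
  (forall x, K x -> rnorm (a - lsubmx x) <= r /\ rnorm (b - rsubmx x) <= r) ->
  usc_on K f -> weak_submean G f ->
  (forall x, K x -> ~ G x -> (f x <= (g (u (lsubmx x) + v (rsubmx x)))%:E)%E) ->
  forall x, K x -> (f x <= (g (u (lsubmx x) + v (rsubmx x)))%:E)%E.
Proof.
move=> r0 gu gv gs cK oG GK Kr uf sf bd x Kx.
have [C1 uC] := good_ball_bound r0 gu; have [C2 vC] := good_ball_bound r0 gv.
have [U1 [pU1 mU1 DU1]] := gu; have [U2 [pU2 mU2 DU2]] := gv.
pose D1 := [set y : V | rnorm (a - y) < 3 * r]; pose D2 := [set y : V | rnorm (b - y) < 3 * r].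
pose row (p : V * V) : W := row_mx p.1 p.2.
have lt3 y : y <= r -> y < 3 * r by move=> h; apply: le_lt_trans h _; rewrite ltr_pMl// ltr1n.
have rowline p q (z : R[i]) : row (p + z *: q) = row p + z *: row q by exact: row_mx_line.
have crow : continuous row by exact: continuous_row_mx.
have KR p : K (row p) -> rnorm (a - p.1) <= r /\ rnorm (b - p.2) <= r.
  by move=> /Kr; rewrite /row row_mxKl row_mxKr.
have gm := let: And3 h _ _ := gs in h.
have := @local_comparison R V V D1 D2 u (plug u a r C1) v (plug v b r C2)
  (row @^-1` K) (row @^-1` G) (f \o row) g (open_rball _ _) (open_rball _ _)
  (plug_usc mU1 DU1 uC) (plug_usc mU2 DU2 vC) (usc_on_sub DU1 (PSH_usc mU1.1)) _ _
  (usc_on_sub DU2 (PSH_usc mU2.1)) _ _ _ _ _ _ _ _ gs _.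
move=> /(_ _)/wrap[].
  by move=> p c P Dc; apply: (submean_weak (PSH_submean mU1.1)) => z /Dc/DU1.
move=> /(_ _)/wrap[]; first by move=> y _; exact: plug_ge.
move=> /(_ _)/wrap[].
  by move=> p c P Dc; apply: (submean_weak (PSH_submean mU2.1)) => z /Dc/DU2.
move=> /(_ _)/wrap[]; first by move=> y _; exact: plug_ge.
move=> /(_ _)/wrap[].
  pose un (y : W) : V * V := (lsubmx y, rsubmx y).
  have cun : continuous un.
    move=> y A /nbhs_ballP[e e0 eA]; apply/nbhs_ballP; exists e => // z [_ yz]; apply: eA.
    by split; split=> // i j; rewrite !mxE; exact: yz.
  have cI := continuous_compact (continuous_subspaceT cun) cK.
  apply: (subclosed_compact _ cI).
    apply: preimage_closed; first by move=> p _; exact: crow.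
    by apply: compact_closed => //; exact: (@norm_hausdorff _ W).
  by move=> p /= Kp; exists (row p) => //; rewrite /un /row row_mxKl row_mxKr; case: p {Kp}.
move=> /(_ _)/wrap[]; first by move=> p /= /GK.
move=> /(_ _)/wrap[]; first by apply: open_comp => // p _; exact: crow.
move=> /(_ _)/wrap[]; first by move=> p /= /KR[h1 h2]; split; exact: lt3.
move=> /(_ _)/wrap[]; first by apply: (usc_on_comp uf crow).
move=> /(_ _)/wrap[].
  move=> p q P Gq fq; apply: (sf (row p) (row q)) => z z1; rewrite -rowline; first exact: Gq.
  exact: fq.
move=> /(_ _)/wrap[].
  by move=> p /= Kp Gp; have := bd (row p) Kp Gp; rewrite /row row_mxKl row_mxKr.
(* The first entry is a coordinate along the vector of ones, as [slice_max] requires. *)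
pose l (y : V) : R[i] := y 0 0.
have cl : continuous l by exact: coord_continuous.
have lB (p : V) (z : R[i]) : l (p + z *: const_mx 1) = l p + z by rewrite /l !mxE mulr1.
move=> /(_ _ _ _ _ cl lB cl lB C1 C2).
move=> /(_ _)/wrap[]; first by move=> p /= /KR[h1 h2]; rewrite /plug h1.
move=> /(_ _)/wrap[]; first by move=> p /= /KR[h1 h2]; rewrite /plug h2.
move=> /(_ (lsubmx x, rsubmx x)); rewrite /= /row /= hsubmxK => /(_ Kx)/le_trans; apply.
have [h1 h2] := Kr x Kx.
rewrite lee_fin; apply: gm; apply: leeD.
  exact: (env_lim_plug_le pU1 mU1 r0 DU1 uC (lt3 _ h1)).
exact: (env_lim_plug_le pU2 mU2 r0 DU2 vC (lt3 _ h2)).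
Qed.

End box.

(** * From local to global maximality *)

Section main.
Context {R : realType} {n : nat}.
Local Notation V := 'rV[R[i]]_n.+1.
Local Notation W := 'rV[R[i]]_(n.+1 + n.+1).

Lemma rnorm_lsubmx (x : W) : rnorm (lsubmx x : V) ^+ 2 <= sqnorm x.
Proof.
rewrite -[x]hsubmxK sqnorm_row_mx row_mxKl.
by apply: le_trans (rnorm_le_sqnorm _) _; rewrite lerDl sqnorm_ge0.
Qed.

Lemma rnorm_rsubmx (x : W) : rnorm (rsubmx x : V) ^+ 2 <= sqnorm x.
Proof.
rewrite -[x]hsubmxK sqnorm_row_mx row_mxKr.
by apply: le_trans (rnorm_le_sqnorm _) _; rewrite lerDr sqnorm_ge0.
Qed.

Lemma lsubmxB (x y : W) : lsubmx (x - y) = lsubmx x - lsubmx y :> V.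
Proof. by apply/matrixP => i j; rewrite !mxE. Qed.

Lemma rsubmxB (x y : W) : rsubmx (x - y) = rsubmx x - rsubmx y :> V.
Proof. by apply/matrixP => i j; rewrite !mxE. Qed.

(* [f - g] is bounded and the radius [r] of local maximality is uniform on
   [closure G]; so adding [d * sqnorm] and starting near the supremum, one gains
   [d * r ^+ 2] in a single box, without any semicontinuity of [f - g]. *)
Lemma cut_maximal (Omega : set V) (u v : V -> \bar R) (G : set W) (g : \bar R -> R) (cl : R)
    (f : W -> \bar R) :
  MPSH_loc Omega u -> MPSH_loc Omega v -> open G -> compact (closure G) ->
  closure G `<=` cprod Omega Omega ->
  truncated_shape g -> (forall x, cl <= g x) ->
  usc_on (closure G) f -> weak_submean G f -> (forall x, closure G x -> (cl%:E <= f x)%E) ->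
  (forall x, closure G x -> ~ G x -> (f x <= (g (u (lsubmx x) + v (rsubmx x)))%:E)%E) ->
  forall x, G x -> (f x <= (g (u (lsubmx x) + v (rsubmx x)))%:E)%E.
Proof.
move=> lu lv oG cG GO gs gl uf sf fl bd x1 Gx1; rewrite leNgt; apply/negP => lt1.
have GcG : G `<=` closure G by exact: subset_closure.
pose s (x : W) := g (u (lsubmx x) + v (rsubmx x)).
pose f1 x := fine (f x).
have f1E x : closure G x -> f x = (f1 x)%:E.
  by move=> Gx; rewrite /f1; move: (uf.1 x Gx) (fl x Gx); case: (f x).
have [M _ fM] := usc_compact_bound cG uf.
have f1M x : closure G x -> f1 x <= M by move=> Gx; rewrite -lee_fin -f1E// fM.
have [B B0 eB] := continuous_compact_bound cG (@continuous_sqnorm R _).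
have [r r0 gr] := uniform_good_ball lu lv cG GO.
pose c0 := f1 x1 - s x1.
have c00 : 0 < c0.
  by rewrite subr_gt0 -lte_fin -f1E//; exact: GcG.
clear lt1.
(* With [d = c0 / (2 * D)], the terms [d * B] and [d * r ^+ 2] together stay below half of the
   excess [c0], which settles the part of the box on the boundary of [G]. *)
pose D := B + r ^+ 2 + 1.
have D0 : 0 < D by rewrite ltr_wpDl// addr_ge0// sqr_ge0.
pose d := c0 / (2 * D).
have d0 : 0 < d by rewrite divr_gt0// mulr_gt0.
have dD : d * D = c0 / 2 by rewrite /d; field; rewrite gt_eqF.
have dBr : d * B + d * r ^+ 2 <= c0 / 2.
  by rewrite -dD /D !mulrDr mulr1; have := ltW d0; lra.
pose q x := f1 x + d * sqnorm x - s x.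
pose A := [set q x | x in G].
have A0 : A !=set0 by exists (q x1); exists x1.
have Aub : has_ubound A.
  exists (M + d * B - cl) => _ [x Gx <-]; rewrite /q.
  have := f1M x (GcG x Gx); have := gl (u (lsubmx x) + v (rsubmx x)); rewrite -/(s x).
  have := ler_wpM2l (ltW d0) (eB x (GcG x Gx)); lra.
have qA x : G x -> q x <= sup A by move=> Gx; apply: ub_le_sup => //; exists x.
have c0A : c0 <= sup A.
  apply: le_trans (qA x1 Gx1); rewrite /q /c0.
  have := mulr_ge0 (ltW d0) (sqnorm_ge0 x1); lra.
have dr0 : 0 < d * r ^+ 2 by rewrite mulr_gt0// exprn_gt0.
have [_ [x0 Gx0 <-] qx0] := sup_adherent dr0 (conj A0 Aub).
pose K := closure G `&` ([set x | rnorm (lsubmx x0 - lsubmx x : V) <= r] `&`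
   [set x | rnorm (rsubmx x0 - rsubmx x : V) <= r]).
pose G1 := G `&` ([set x | rnorm (lsubmx x0 - lsubmx x : V) < r] `&`
   [set x | rnorm (rsubmx x0 - rsubmx x : V) < r]).
have cn1 : continuous (fun x : W => rnorm (lsubmx x0 - lsubmx x : V)).
  move=> x; apply: (@cvg_comp _ _ _ (fun x : W => lsubmx x : V) (fun y => rnorm (lsubmx x0 - y))
    (nbhs x) (nbhs (lsubmx x : V))); first exact: (@continuous_lsubmx R[i] 1 n.+1 n.+1 x).
  exact: continuous_rnormB.
have cn2 : continuous (fun x : W => rnorm (rsubmx x0 - rsubmx x : V)).
  move=> x; apply: (@cvg_comp _ _ _ (fun x : W => rsubmx x : V) (fun y => rnorm (rsubmx x0 - y))
    (nbhs x) (nbhs (rsubmx x : V))); first exact: (@continuous_rsubmx R[i] 1 n.+1 n.+1 x).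
  exact: continuous_rnormB.
(* By [sqnormB], [h] differs from [f1] by the real part of an affine function. On the sides of the
   box [sqnorm (x - x0)] is at least [r ^+ 2], so [q <= sup A] gives [h <= s]. At [x0] the
   conclusion [h <= s] reads [q x0 <= sup A - d * r ^+ 2], against the choice of [x0]. *)
pose h x := f1 x + d * (sqnorm x - sqnorm (x - x0)) - sup A + d * r ^+ 2.
have [gl0 gr0] := gr x0 (GcG _ Gx0).
have := @box_comparison R n u v (lsubmx x0) (rsubmx x0) r g K G1 (fun x => (h x)%:E) r0 gl0 gr0 gs.
move=> /(_ _)/wrap[].
  apply: (subclosed_compact _ cG); last by move=> x [].
  apply: closedI; first exact: closed_closure.
  apply: closedI.
    rewrite (_ : [set _ | _] = (fun x : W => rnorm (lsubmx x0 - lsubmx x : V)) @^-1` [set t | t <= r])//.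
    by apply: preimage_closed; [move=> x _; exact: cn1|exact: closed_le].
  rewrite (_ : [set _ | _] = (fun x : W => rnorm (rsubmx x0 - rsubmx x : V)) @^-1` [set t | t <= r])//.
  by apply: preimage_closed; [move=> x _; exact: cn2|exact: closed_le].
move=> /(_ _)/wrap[].
  apply: openI => //; apply: openI.
    rewrite (_ : [set _ | _] = (fun x : W => rnorm (lsubmx x0 - lsubmx x : V)) @^-1` [set t | t < r])//.
    by apply: open_comp; [move=> x _; exact: cn1|exact: open_lt].
  rewrite (_ : [set _ | _] = (fun x : W => rnorm (rsubmx x0 - rsubmx x : V)) @^-1` [set t | t < r])//.
  by apply: open_comp; [move=> x _; exact: cn2|exact: open_lt].
move=> /(_ _)/wrap[].
  by move=> x [Gx [/ltW h1 /ltW h2]]; split; [exact: GcG|split].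
move=> /(_ _)/wrap[]; first by move=> x [_ []].
pose L (x : W) := \sum_i conjc (x0 0 i) * x 0 i.
have hE x : h x = f1 x + (2 * d * complex.Re (L x) - d * sqnorm x0 - sup A + d * r ^+ 2).
  by rewrite /h sqnormB -/(L x); ring.
move=> /(_ _)/wrap[].
  split=> [x _|x a [Gx Bx]]; first by rewrite ltry.
  rewrite lte_fin => ha; pose e := (a - h x) / 2.
  have e0 : 0 < e by rewrite divr_gt0// subr_gt0.
  have cB : continuous (fun y : W => sqnorm (y - x0)).
    move=> y; apply: (@cvg_comp _ _ _ (fun y : W => y - x0) sqnorm (nbhs y) (nbhs (y - x0))).
      by apply: (@cvgB _ _ _ (nbhs y)); [exact: cvg_id|exact: cvg_cst].
    exact: continuous_sqnorm.
  have ck : d * (sqnorm y - sqnorm (y - x0)) @[y --> x] --> d * (sqnorm x - sqnorm (x - x0)).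
    apply: (@cvgM _ _ (nbhs x)); first exact: cvg_cst.
    by apply: (@cvgB _ _ _ (nbhs x)); [exact: continuous_sqnorm|exact: cB].
  have fe : (f x < (f1 x + e)%:E)%E by rewrite f1E// lte_fin ltrDl.
  have := uf.2 x (f1 x + e) Gx fe; rewrite !near_withinE => n1.
  near=> y => -[Gy By]; rewrite lte_fin.
  have : closure G y -> (f y < (f1 x + e)%:E)%E by near: y.
  move=> /(_ Gy); rewrite f1E// lte_fin => hy1.
  have hy2 : d * (sqnorm y - sqnorm (y - x0)) < d * (sqnorm x - sqnorm (x - x0)) + e.
    by near: y; apply: (cvgr_lt _ ck); rewrite ltrDl.
  have he : e * 2 = a - h x by rewrite /e divfK.
  by move: hy1 hy2 he; rewrite /h; clear; lra.
move=> /(_ _)/wrap[].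
  move=> p b P Gb hP.
  pose k := - d * sqnorm x0 - sup A + d * r ^+ 2.
  pose Q := P - (2 * d)%:C%C *: ((L p)%:P + L b *: 'X) - k%:C%C%:P.
  have Ll z : L (p + z *: b) = L p + z * L b.
    rewrite /L mulr_sumr -big_split; apply: eq_bigr => i _ /=.
    by rewrite !mxE; ring.
  have QE z : complex.Re Q.[z] = complex.Re P.[z] - 2 * d * complex.Re (L (p + z *: b)) - k.
    rewrite Ll /Q !(hornerD, hornerN, hornerC, hornerZ, hornerX).
    by clearbody k; clear; move: (P.[z]) (L p) (L b) => [p1 p2] [q1 q2] [l1 l2]; case: z => z1 z2 /=; ring.
  have Gp : closure G p.
    by have [] := Gb 0; rewrite ?normr0 ?ler01// scale0r addr0 => /GcG.
  have := sf p b Q; rewrite (f1E p Gp) !lee_fin QE scale0r addr0 hE => hh.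
  suff : f1 p <= complex.Re P.[0] - 2 * d * complex.Re (L p) - k by rewrite /k; lra.
  apply: hh; first by move=> z /Gb[].
  move=> z z1; have z1' : `|z| <= 1 by rewrite z1.
  have Gz : closure G (p + z *: b) by apply: GcG; have [] := Gb z z1'.
  have := hP z z1.
  rewrite (f1E _ Gz).
  rewrite !lee_fin.
  rewrite QE hE.
  rewrite /k.
  move: (complex.Re _) (complex.Re _) (f1 _) (sqnorm _) (sup _) => t1 t2 t3 t4 t5; clear.
  lra.
move=> /(_ _)/wrap[].
  move=> x [Gx [xl xr]] nG1; rewrite lee_fin -/(s x).
  have [Gx'|nGx] := pselect (G x); last first.
    have : f1 x <= s x by rewrite -lee_fin -f1E//; exact: bd.
    have := mulr_ge0 (ltW d0) (sqnorm_ge0 (x - x0)).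
    have := ler_wpM2l (ltW d0) (eB x Gx).
    by rewrite /h mulrBr; clear -dBr c0A c00; lra.
  have : r ^+ 2 <= sqnorm (x - x0).
    have [hl|hl] := ltP (rnorm (lsubmx x0 - lsubmx x : V)) r; last first.
      apply: le_trans (rnorm_lsubmx (x - x0)).
      by rewrite lsubmxB -opprB rnormN lerXn2r ?nnegrE ?rnorm_ge0// ltW.
    have [hr|hr] := ltP (rnorm (rsubmx x0 - rsubmx x : V)) r; last first.
      apply: le_trans (rnorm_rsubmx (x - x0)).
      by rewrite rsubmxB -opprB rnormN lerXn2r ?nnegrE ?rnorm_ge0// ltW.
    by case: nG1; split.
  move=> /(ler_wpM2l (ltW d0)); have := qA x Gx'; rewrite /q /h mulrBr; clear; lra.
move=> /(_ x0)/(_ _)/wrap[].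
  split; first exact: GcG.
  by split; rewrite /= subrr /rnorm normr0 /= ltW.
rewrite lee_fin -/(s x0) /h subrr.
have -> : sqnorm (0 : W) = 0.
  by rewrite /sqnorm big1// => i _; rewrite mxE Normc.normc0 expr0n.
rewrite subr0; move: qx0; rewrite /q; clear; lra.
Unshelve. all: by end_near. Qed.

End main.

Theorem theorem0p3 (R : realType) (n : nat) (Omega : set 'rV[R[i]]_n)
    (u v : 'rV[R[i]]_n -> \bar R) (chi : R -> R) :
  (2 <= n)%N ->
  Omega !=set0 -> open Omega -> connected Omega -> bounded_set Omega ->
  MPSH_loc Omega u -> MPSH_loc Omega v ->
  convex_function [set: convex_lmodType R^o] chi ->
  {homo chi : x y / x <= y} ->
  MPSH (cprod Omega Omega) (chi_sum chi u v).
Proof.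
case: n Omega u v => [//|n] Omega u v _ _ _ cO _ lu lv cchi mchi.
have [pu _] := lu; have [pv _] := lv.
split; first exact: PSH_chi_sum.
move=> G w oG [pG GO] uw pw bd x Gx.
have cG : compact (closure G) by rewrite -precompactE.
have [M1 _ uM] := usc_compact_bound cG
  (usc_on_comp (PSH_usc pu) (@continuous_lsubmx R[i] 1 n.+1 n.+1) (fun y Gy => (GO y Gy).1)).
have [M2 _ vM] := usc_compact_bound cG
  (usc_on_comp (PSH_usc pv) (@continuous_rsubmx R[i] 1 n.+1 n.+1) (fun y Gy => (GO y Gy).2)).
pose M := M1 + M2.
pose s y := (u (lsubmx y) + v (rsubmx y))%E.
have sM y : closure G y -> (s y <= M%:E)%E.
  by move=> Gy; rewrite /s EFinD leeD ?uM ?vM.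
(* Taking the maximum with [chi m] bounds [w] from below, and it respects the boundary inequality
   because the truncated function is at least [chi m]. *)
have cut m : m <= M -> (w x <= (chi_cut chi m M (s x))%:E)%E.
  move=> mM; apply: (@le_trans _ _ (maxe (w x) (chi m)%:E)); first by rewrite le_max lexx.
  apply: (@cut_maximal R n Omega u v G (chi_cut chi m M) (chi m)
    (fun y => maxe (w y) (chi m)%:E)) => //.
  - exact: chi_cut_shape.
  - by move=> y; exact: chi_cut_ge_low.
  - split=> [y Gy|y a Gy]; first by rewrite gt_max uw.1// ltry.
    rewrite gt_max => /andP[wa ma]; have := uw.2 y a Gy wa; rewrite !near_withinE.
    by apply: filterS => z hz Gz; rewrite gt_max hz.
  - apply: submean_weak => p b Gb; rewrite ge_max; apply/andP; split.
      apply: le_trans (PSH_submean pw Gb) _; apply: circle_mean_le => t.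
      by rewrite le_max lexx.
    by apply: circle_mean_ge => z _; rewrite le_max lexx orbT.
  - by move=> y _; rewrite le_max lexx orbT.
  - move=> y Gy nGy; rewrite ge_max lee_fin chi_cut_ge_low// andbT.
    apply: (@le_trans _ _ (chi_sum chi u v y)).
      by apply: bd; split=> // Gy'; apply: nGy; exact: interior_subset Gy'.
    exact: (extend_ninfty_le_cut mchi _ (sM y Gy)).
have Gcx := @subset_closure _ _ _ Gx.
(* At a finite value [r] the cut at [m = r] already returns [chi r]; at [-oo] the infimum over all
   cuts is taken. *)
rewrite /chi_sum -/(s x); case e : (s x) (sM x Gcx) => [r||] // sxM.
  have rM : r <= M by rewrite -lee_fin.
  by have := cut r rM; rewrite e chi_cut_mid.
rewrite extend_ninftyE//; apply: le_ereal_inf_tmp => _ [t _ <-].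
have tM : Num.min t M <= M by rewrite ge_min lexx orbT.
have := cut _ tM; rewrite e chi_cut_low ?leNye// => /le_trans; apply.
by rewrite lee_fin; apply: mchi; rewrite ge_min lexx.
Qed.
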